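(* Let $q_1,q_2,q_3>0$ and consider the Coulomb energy $E=\frac{q_1q_2}{l_3}+\frac{q_2q_3}{l_1}+\frac{q_3q_1}{l_2}$ on $M(3)$. Then $E$ has three poles: the configurations with $p_1=p_2$, with $p_2=p_3$, and with $p_1=p_3$. Moreover: (1) If the triple $\left(\frac1{\sqrt{q_1}},\frac1{\sqrt{q_2}},\frac1{\sqrt{q_3}}\right)$ satisfies the strict triangle inequalities, then (a) $E$ has exactly two minimum points; they are two mutually symmetric triangles whose sidelengths satisfy $(l_1:l_2:l_3)=\left(\frac1{\sqrt{q_1}}:\frac1{\sqrt{q_2}}:\frac1{\sqrt{q_3}}\right)$; (b) $E$ has exactly three saddle Morse points; they are the aligned configurations $A_1,A_2,A_3$. (2) If $\frac1{\sqrt{q_1}}>\frac1{\sqrt{q_2}}+\frac1{\sqrt{q_3}}$, then (a) $E$ has exactly one minimum point; it is the aligned configuration $A_1$ (with $p_1$ lying between $p_2$ and $p_3$); (b) $E$ has exactly two saddle Morse points; they are the aligned configurations $A_2$ and $A_3$. (3) If $\frac1{\sqrt{q_1}}=\frac1{\sqrt{q_2}}+\frac1{\sqrt{q_3}}$, then (a) $E$ has exactly one minimum point; it is degenerate and is the aligned configuration $A_1$; (b) $E$ has exactly two non-degenerate saddle Morse points; they are $A_2$ and $A_3$.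
   Context: $M(3)=\{(p_1,p_2,p_3)\mid p_i\in\mathbb{R}^2,\ p_1=0,\ |p_1p_2|+|p_2p_3|+|p_3p_1|=1\}/SO(2)$ is the space of (possibly degenerate) planar labeled triangles of perimeter $1$ up to orientation-preserving motions; mirror images are not identified. It is a $2$-sphere, and it is a smooth surface near every configuration with pairwise distinct points. Notation: $l_1=|p_2p_3|$, $l_2=|p_3p_1|$, $l_3=|p_1p_2|$. $E$ is smooth on the set of configurations with pairwise distinct points; a pole is a point of $M(3)$ at which $E$ tends to $+\infty$. Two configurations are mutually symmetric if they are interchanged by the involution of $M(3)$ induced by reflection in a line. A minimum point means a local minimum point of $E$; a saddle Morse point means a non-degenerate critical point of Morse index $1$; a critical point is degenerate if the Hessian of $E$ there is singular. A configuration is aligned if all its points lie on one line. For $\{i,j,k\}=\{1,2,3\}$, $A_k\in M(3)$ denotes the aligned configuration in which $p_k$ lies strictly between $p_i$ and $p_j$ (so that $|p_ip_j|=\tfrac12$) and $\frac{|p_ip_k|}{|p_kp_j|}=\frac{\sqrt{q_i}}{\sqrt{q_j}}$. *)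

(* Defs.v *)
From HB Require Import structures.
From mathcomp Require Import all_boot all_order all_algebra.
From mathcomp Require Import generic_quotient.
From mathcomp Require Import all_classical all_reals all_analysis.
From mathcomp Require Import ring lra.

Set Implicit Arguments.
Unset Strict Implicit.
Unset Printing Implicit Defensive.

Import Order.TTheory GRing.Theory Num.Theory.
Import numFieldNormedType.Exports.

Local Open Scope classical_set_scope.
Local Open Scope ring_scope.
Local Open Scope quotient_scope.

Section Plane.
Context {R : realType}.
Implicit Types (a b c : 'rV[R]_2) (A : 'M[R]_2).

Definition vec (x y : R) : 'rV[R]_2 := \row_j (if j == 0 then x else y).

(* The library norm on 'rV[R]_2 is the sup norm, so the Euclidean distance is
   defined here; both induce the same topology. *)
Definition eucl_dist a b : R := Num.sqrt (\sum_j (a 0 j - b 0 j) ^+ 2).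

Definition SO2 A : Prop := A *m A^T = 1%:M /\ \det A = 1.

Definition reflx : 'M[R]_2 := diag_mx (vec 1 (- 1)).

Definition strictly_between a c b : Prop :=
  a != b /\ exists2 t : R, 0 < t < 1 & c = (1 - t) *: a + t *: b.

Definition collinear a b c : Prop :=
  exists o d : 'rV[R]_2, d != 0 /\
    exists s t u : R, [/\ a = o + s *: d, b = o + t *: d & c = o + u *: d].

Lemma eucl_distE a b :
  eucl_dist a b = Num.sqrt ((a 0 0 - b 0 0) ^+ 2 + (a 0 1 - b 0 1) ^+ 2).
Proof.
by rewrite /eucl_dist big_ord_recl big_ord1; congr (Num.sqrt (_ + (a 0 _ - b 0 _) ^+ 2));
  apply: val_inj.
Qed.

Lemma vecE0 (x y : R) : vec x y 0 0 = x. Proof. by rewrite mxE. Qed.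
Lemma vecE1 (x y : R) : vec x y 0 1 = y. Proof. by rewrite mxE. Qed.

Lemma vecP a b : a 0 0 = b 0 0 -> a 0 1 = b 0 1 -> a = b.
Proof.
move=> h0 h1; apply/rowP => j.
have [->|->] // : j = 0 \/ j = 1.
by case: j => -[|[|//]] i; [left|right]; apply: val_inj.
Qed.

Lemma mulrv0 a A : (a *m A) 0 0 = a 0 0 * A 0 0 + a 0 1 * A 1 0.
Proof.
rewrite mxE big_ord_recl big_ord1.
by congr (_ + a 0 _ * A _ 0); apply: val_inj.
Qed.

Lemma mulrv1 a A : (a *m A) 0 1 = a 0 0 * A 0 1 + a 0 1 * A 1 1.
Proof.
rewrite mxE big_ord_recl big_ord1.
by congr (_ + a 0 _ * A _ 1); apply: val_inj.
Qed.

Lemma eucl_distMr A a b : A *m A^T = 1%:M -> eucl_dist (a *m A) (b *m A) = eucl_dist a b.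
Proof.
move=> hA.
have E (v w : 'rV[R]_2) : eucl_dist v w = Num.sqrt (((v - w) *m (v - w)^T) 0 0).
  rewrite /eucl_dist mxE; congr (Num.sqrt _); apply: eq_bigr => j _.
  by rewrite !mxE expr2.
by rewrite !E -mulmxBl trmx_mul mulmxA -(mulmxA _ A) hA mulmx1.
Qed.

Lemma det_mx22 A : \det A = A 0 0 * A 1 1 - A 0 1 * A 1 0.
Proof.
rewrite (expand_det_row _ 0) !big_ord_recl big_ord0 /cofactor !det_mx11 !mxE /=.
rewrite addr0 expr0 mul1r expr1 mulN1r mulrN.
by congr (_ * A _ _ - A _ _ * A _ _); apply: val_inj.
Qed.

Lemma SO2_entries A : SO2 A ->
  [/\ A 1 0 = - A 0 1, A 1 1 = A 0 0 & A 0 0 ^+ 2 + A 0 1 ^+ 2 = 1].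
Proof.
move=> [/matrixP hA hd]; have := hA 0 0; have := hA 0 1; have := hA 1 1.
rewrite !mxE !big_ord_recl !big_ord0 !mxE /=.
move: hd; rewrite det_mx22.
rewrite (_ : lift ord0 ord0 = 1 :> 'I_2); last exact: val_inj.
rewrite (_ : ord0 = 0 :> 'I_2); last exact: val_inj.
rewrite !addr0; move: (A 0 0) (A 0 1) (A 1 0) (A 1 1) => u v w t hd h1 h01 h0.
have h01' : u * w + v * t = 0 by [].
have h0' : u * u + v * v = 1 by [].
have hw : w = - v.
  transitivity (w * (u * u + v * v)); first by rewrite h0' mulr1.
  transitivity (u * (u * w + v * t) - v * (u * t - v * w)); first by ring.
  by rewrite h01' hd; ring.
have ht : t = u.
  transitivity (t * (u * u + v * v)); first by rewrite h0' mulr1.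
  transitivity (v * (u * w + v * t) + u * (u * t - v * w)); first by ring.
  by rewrite h01' hd; ring.
by split => //; rewrite !expr2.
Qed.

Lemma eucl_dist_eq0 a b : (eucl_dist a b == 0) = (a == b).
Proof.
apply/eqP/eqP => [|->]; last first.
  by rewrite eucl_distE !subrr expr0n addr0 sqrtr0.
rewrite eucl_distE => /eqP; rewrite sqrtr_eq0 => h.
have h0 := sqr_ge0 (a 0 0 - b 0 0); have h1 := sqr_ge0 (a 0 1 - b 0 1).
apply: vecP; apply/eqP; rewrite -subr_eq0 -sqrf_eq0; apply/eqP; lra.
Qed.

End Plane.

Section Triangles.
Context {R : realType}.

(* The triple (p_1, p_2, p_3) is ((p_1, p_2), p_3). *)
Definition normalized : set ('rV[R]_2 * 'rV[R]_2 * 'rV[R]_2) :=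
  [set p | p.1.1 = 0 /\
    eucl_dist p.1.1 p.1.2 + eucl_dist p.1.2 p.2 + eucl_dist p.2 p.1.1 = 1].

(* Carries the subspace topology. *)
Definition config : Type := set_type normalized.

HB.instance Definition _ := Choice.on config.
HB.instance Definition _ := Topological.on config.

Definition p1 (P : config) : 'rV[R]_2 := (set_val P).1.1.
Definition p2 (P : config) : 'rV[R]_2 := (set_val P).1.2.
Definition p3 (P : config) : 'rV[R]_2 := (set_val P).2.

Definition rotated (P Q : config) : Prop :=
  exists2 A : 'M[R]_2, SO2 A &
    [/\ p1 Q = p1 P *m A, p2 Q = p2 P *m A & p3 Q = p3 P *m A].

Definition rotatedb (P Q : config) : bool := `[< rotated P Q >].

Lemma config_eq (P Q : config) :
  p1 P = p1 Q -> p2 P = p2 Q -> p3 P = p3 Q -> P = Q.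
Proof.
rewrite /p1 /p2 /p3 set_valE => e1 e2 e3; apply: val_inj.
by case: P Q e1 e2 e3 => [[[? ?] ?] ?] [[[? ?] ?] ?] /= -> -> ->.
Qed.

Lemma rotatedb_equiv : equiv_class_of rotatedb.
Proof.
split.
- move=> P; apply/asboolP; exists 1%:M; last by rewrite !mulmx1.
  by split; rewrite ?det1 // trmx1 mulmx1.
- suff S P Q : rotated P Q -> rotated Q P.
    by move=> P Q; apply/asboolP/asboolP; exact: S.
  move=> [A [hA dA] [e1 e2 e3]]; exists A^T.
    by split; [rewrite trmxK; exact: mulmx1C | rewrite det_tr].
  by rewrite e1 e2 e3 -!mulmxA hA !mulmx1.
- move=> Q P S /asboolP[A [hA dA] [e1 e2 e3]] /asboolP[B [hB dB] [f1 f2 f3]].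
  apply/asboolP; exists (A *m B).
    by split; rewrite ?det_mulmx ?dA ?dB ?mulr1 // trmx_mul mulmxA -(mulmxA A) hB mulmx1.
  by rewrite f1 f2 f3 e1 e2 e3 !mulmxA.
Qed.

Canonical rotatedb_equiv_rel := EquivRelPack rotatedb_equiv.

Lemma eq_quot_rotated (P Q : config) :
  P = Q %[mod {eq_quot rotatedb}] <-> rotated P Q.
Proof. by split => [/eqmodP/asboolP|h] //; apply/eqmodP/asboolP. Qed.

Definition M3 : Type := quotient_topology {eq_quot rotatedb}.

HB.instance Definition _ := Choice.on M3.
HB.instance Definition _ := Topological.on M3.
HB.instance Definition _ := Quotient.on M3.

Implicit Types (P Q : config) (x y : M3).

Lemma M3_eqP P Q : \pi_M3 P = \pi_M3 Q <-> rotated P Q.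
Proof. exact: eq_quot_rotated. Qed.

Lemma repr_rotated P : rotated P (repr (\pi_M3 P)).
Proof. by apply/M3_eqP; rewrite reprK. Qed.

Definition l1 x : R := eucl_dist (p2 (repr x)) (p3 (repr x)).
Definition l2 x : R := eucl_dist (p3 (repr x)) (p1 (repr x)).
Definition l3 x : R := eucl_dist (p1 (repr x)) (p2 (repr x)).

Lemma l1_pi P : l1 (\pi_M3 P) = eucl_dist (p2 P) (p3 P).
Proof.
by rewrite /l1; have [A [hA _] [_ -> ->]] := repr_rotated P; exact: eucl_distMr.
Qed.
Lemma l2_pi P : l2 (\pi_M3 P) = eucl_dist (p3 P) (p1 P).
Proof.
by rewrite /l2; have [A [hA _] [-> _ ->]] := repr_rotated P; exact: eucl_distMr.
Qed.
Lemma l3_pi P : l3 (\pi_M3 P) = eucl_dist (p1 P) (p2 P).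
Proof.
by rewrite /l3; have [A [hA _] [-> -> _]] := repr_rotated P; exact: eucl_distMr.
Qed.

(* Only meaningful on [distinct] below, since x / 0 = 0; all the notions of
   critical point theory are restricted to that open set. *)
Definition coulomb (q1 q2 q3 : R) x : R :=
  q1 * q2 / l3 x + q2 * q3 / l1 x + q3 * q1 / l2 x.

Definition meet12 x : Prop := p1 (repr x) = p2 (repr x).
Definition meet23 x : Prop := p2 (repr x) = p3 (repr x).
Definition meet13 x : Prop := p1 (repr x) = p3 (repr x).

Definition distinct : set M3 :=
  [set x | [/\ ~ meet12 x, ~ meet23 x & ~ meet13 x]].

Lemma reflx_normalized P :
  normalized (p1 P *m reflx, p2 P *m reflx, p3 P *m reflx).
Proof.
have h : @reflx R *m reflx^T = 1%:M.
  rewrite /reflx tr_diag_mx mulmx_diag; apply/matrixP => i j; rewrite !mxE.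
  by case: (i == 0); rewrite ?mulrNN mulr1.
have [h0 hP] := set_mem (valP P).
split => /=; first by rewrite [p1 P]h0 mul0mx.
by rewrite !eucl_distMr.
Qed.

Definition mirror_config P : config := SigSub (mem_set (reflx_normalized P)).

(* Reflections in two different lines through p_1 = 0 differ by a rotation, so
   the choice of the first coordinate axis is immaterial. *)
Definition mirror x : M3 := \pi_M3 (mirror_config (repr x)).

(* Smooth structure on the classes of configurations with distinct points.
   Identifying the plane with the complex numbers, z = (p_3 - p_1) / (p_2 - p_1)
   is, on the smooth 3-manifold of normalized configurations with distinct
   points, a submersion onto the plane minus {0, 1} whose fibres are exactly the
   SO(2)-orbits.  Hence it induces a global chart [chart] of the quotient, with
   inverse [chart_inv]; derivatives on M(3) are computed in it. *)
Definition chart_config P : 'rV[R]_2 :=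
  let a := p2 P in let b := p3 P in
  vec ((a 0 0 * b 0 0 + a 0 1 * b 0 1) / (a 0 0 ^+ 2 + a 0 1 ^+ 2))
      ((a 0 0 * b 0 1 - a 0 1 * b 0 0) / (a 0 0 ^+ 2 + a 0 1 ^+ 2)).

Definition chart x : 'rV[R]_2 := chart_config (repr x).

Definition chart_scale (z : 'rV[R]_2) : R :=
  (1 + eucl_dist (vec 1 0) z + eucl_dist z 0)^-1.

Lemma chart_scale_gt0 z : 0 < chart_scale z.
Proof.
by rewrite invr_gt0 -addrA ltr_pwDl ?ltr01 // addr_ge0 // sqrtr_ge0.
Qed.

Lemma eucl_distZ (k : R) (a b : 'rV[R]_2) : 0 <= k ->
  eucl_dist (k *: a) (k *: b) = k * eucl_dist a b.
Proof.
move=> k0; rewrite !eucl_distE !mxE -!mulrBr !exprMn -mulrDr sqrtrM ?sqr_ge0 //.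
by rewrite sqrtr_sqr ger0_norm.
Qed.

Lemma chart_inv_normalized z :
  normalized (0, chart_scale z *: vec 1 0, chart_scale z *: z).
Proof.
split => //=.
have k0 := chart_scale_gt0 z.
rewrite -(scaler0 _ (chart_scale z)) !eucl_distZ ?ltW // -!mulrDr.
have -> : eucl_dist 0 (vec (1 : R) 0) = 1.
  by rewrite eucl_distE vecE0 vecE1 !mxE !sub0r sqrrN expr1n oppr0 expr0n addr0 sqrtr1.
by rewrite mulVf // -invr_eq0 gt_eqF.
Qed.

Definition chart_inv_config z : config := SigSub (mem_set (chart_inv_normalized z)).
Definition chart_inv z : M3 := \pi_M3 (chart_inv_config z).

Lemma meet12E x : meet12 x <-> l3 x = 0.
Proof.
by rewrite /l3; split => [->|/eqP]; [apply/eqP|]; rewrite eucl_dist_eq0 // => /eqP.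
Qed.
Lemma meet23E x : meet23 x <-> l1 x = 0.
Proof.
by rewrite /l1; split => [->|/eqP]; [apply/eqP|]; rewrite eucl_dist_eq0 // => /eqP.
Qed.
Lemma meet13E x : meet13 x <-> l2 x = 0.
Proof.
by rewrite /l2; split => [->|/eqP]; [apply/eqP|]; rewrite eucl_dist_eq0 // => /eqP.
Qed.

Lemma p1_eq0 P : p1 P = 0.
Proof. by have [] := set_mem (valP P). Qed.

Lemma perimeterE P :
  eucl_dist (p1 P) (p2 P) + eucl_dist (p2 P) (p3 P) + eucl_dist (p3 P) (p1 P) = 1.
Proof. by have [] := set_mem (valP P). Qed.

Lemma p1_chart_inv z : p1 (chart_inv_config z) = 0.
Proof. by rewrite /p1 set_valE. Qed.
Lemma p2_chart_inv z : p2 (chart_inv_config z) = chart_scale z *: vec 1 0.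
Proof. by rewrite /p2 set_valE. Qed.
Lemma p3_chart_inv z : p3 (chart_inv_config z) = chart_scale z *: z.
Proof. by rewrite /p3 set_valE. Qed.

Lemma chart_config_rotated P Q : rotated P Q -> chart_config P = chart_config Q.
Proof.
move=> [A /SO2_entries[h1 h2 h3] [_ e2 e3]].
have hn (v : 'rV[R]_2) : (v *m A) 0 0 ^+ 2 + (v *m A) 0 1 ^+ 2 =
    (v 0 0 ^+ 2 + v 0 1 ^+ 2) * (A 0 0 ^+ 2 + A 0 1 ^+ 2).
  by rewrite mulrv0 mulrv1 h1 h2; ring.
apply: vecP; rewrite /chart_config !(vecE0, vecE1) e2 e3 hn h3 mulr1;
  congr (_ / _); rewrite -[LHS]mulr1 -h3 !mulrv0 !mulrv1 h1 h2; ring.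
Qed.

Lemma chart_pi P : chart (\pi_M3 P) = chart_config P.
Proof. by rewrite /chart (chart_config_rotated (repr_rotated P)). Qed.

Lemma chart_invK z : chart (chart_inv z) = z.
Proof.
rewrite chart_pi; have k0 : chart_scale z != 0 by rewrite gt_eqF ?chart_scale_gt0.
apply: vecP; rewrite /chart_config !(vecE0, vecE1) p2_chart_inv p3_chart_inv !mxE /=;
  by field.
Qed.

Lemma chartK x : distinct x -> chart_inv (chart x) = x.
Proof.
move=> [n12 _ _]; rewrite -[RHS]reprK; apply/M3_eqP.
rewrite /chart; set P := repr x; pose z := chart_config P.
have p10 := p1_eq0 P; set a := p2 P; set b := p3 P.
pose d := eucl_dist 0 a.
have dE : d ^+ 2 = a 0 0 ^+ 2 + a 0 1 ^+ 2.
  by rewrite /d eucl_distE sqr_sqrtr ?addr_ge0 ?sqr_ge0 // !mxE !sub0r !sqrrN.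
have d0 : d != 0.
  by rewrite eucl_dist_eq0; apply/eqP => e; apply: n12; rewrite /meet12 -/P p10.
have s0 : a 0 0 ^+ 2 + a 0 1 ^+ 2 != 0 by rewrite -dE expf_neq0.
pose A : 'M[R]_2 := \matrix_(i, j)
  (if i == 0 then if j == 0 then a 0 0 / d else a 0 1 / d
   else if j == 0 then - (a 0 1 / d) else a 0 0 / d).
have AA : SO2 A.
  have hs : (a 0 0 / d) ^+ 2 + (a 0 1 / d) ^+ 2 = 1.
    by rewrite !expr_div_n -mulrDl -dE divff // expf_neq0.
  split; last by rewrite det_mx22 !mxE /= -hs; ring.
  apply/matrixP => i j; rewrite !mxE !big_ord_recl !big_ord0 !mxE /=.
  by case: i j => -[|[|//]] ? [[|[|//]] ?] //=; rewrite -?hs; ring.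
have ea : a = d *: vec 1 0 *m A.
  by apply: vecP; rewrite ?mulrv0 ?mulrv1 !mxE /=; field.
have eb : b = d *: z *m A.
  have z0 : z 0 0 = (a 0 0 * b 0 0 + a 0 1 * b 0 1) / (a 0 0 ^+ 2 + a 0 1 ^+ 2).
    by rewrite vecE0.
  have z1 : z 0 1 = (a 0 0 * b 0 1 - a 0 1 * b 0 0) / (a 0 0 ^+ 2 + a 0 1 ^+ 2).
    by rewrite vecE1.
  by apply: vecP; rewrite ?mulrv0 ?mulrv1 !(mxE _ (fun _ _ => _ * _)) z0 z1 !mxE /=; field;
    rewrite d0 s0.
have dk : d = chart_scale z.
  have := perimeterE P; rewrite p10 -/a -/b -/d.
  have -> : eucl_dist a b = d * eucl_dist (vec 1 0) z.
    by rewrite ea eb eucl_distMr ?(proj1 AA) // eucl_distZ // sqrtr_ge0.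
  have -> : eucl_dist b 0 = d * eucl_dist z 0.
    transitivity (eucl_dist (d *: z *m A) (d *: 0 *m A)).
      by rewrite -eb scaler0 mul0mx.
    by rewrite eucl_distMr ?(proj1 AA) // eucl_distZ // sqrtr_ge0.
  rewrite -[X in X + _ + _]mulr1 -!mulrDr => h.
  by apply: (mulIf (x := 1 + eucl_dist (vec 1 0) z + eucl_dist z 0)); rewrite ?h ?mulVf //;
    rewrite -invr_eq0 gt_eqF ?chart_scale_gt0.
exists A => //; rewrite p1_chart_inv p2_chart_inv p3_chart_inv -/z -dk mul0mx.
by split.
Qed.

Lemma distinct_chart_inv z : distinct (chart_inv z) <-> z != 0 /\ z != vec 1 0.
Proof.
have k0 := chart_scale_gt0 z.
have E (u v : 'rV[R]_2) : eucl_dist (chart_scale z *: u) (chart_scale z *: v) = 0 <-> u = v.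
  rewrite eucl_distZ ?ltW //; split => [/eqP|->]; last first.
    by apply/eqP; rewrite mulf_eq0 eucl_dist_eq0 eqxx orbT.
  by rewrite mulf_eq0 (gt_eqF k0) eucl_dist_eq0 => /eqP.
have e12 : meet12 (chart_inv z) <-> (0 : 'rV[R]_2) = vec 1 0.
  by have := E 0 (vec 1 0); rewrite scaler0 meet12E l3_pi p1_chart_inv p2_chart_inv.
have e23 : meet23 (chart_inv z) <-> vec 1 0 = z.
  by have := E (vec 1 0) z; rewrite meet23E l1_pi p2_chart_inv p3_chart_inv.
have e13 : meet13 (chart_inv z) <-> z = 0.
  by have := E z 0; rewrite scaler0 meet13E l2_pi p1_chart_inv p3_chart_inv.
have n12 : ~ meet12 (chart_inv z).
  by move/e12/rowP/(_ 0); rewrite !mxE => /eqP; rewrite eq_sym oner_eq0.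
split => [[_ n23 n13]|[/eqP z0 /eqP z1]].
  by split; apply/eqP => h; [apply/n13/e13|apply/n23/e23].
by split => //; [move/e23/esym|move/e13].
Qed.

Section CriticalPoints.
Variable f : M3 -> R.

Definition gradient x : 'rV[R]_2 :=
  \row_i 'D_(delta_mx 0 i) (f \o chart_inv) (chart x).

Definition hessian x : 'M[R]_2 :=
  \matrix_(i, j) 'D_(delta_mx 0 i) ('D_(delta_mx 0 j) (f \o chart_inv)) (chart x).

(* The limit is taken along configurations with distinct points, on which f is
   considered; they are dense in M(3). *)
Definition poles : set M3 :=
  [set x | f y @[y --> within distinct (nbhs x)] --> +oo].

Definition minimum_points : set M3 :=
  [set x | distinct x /\ \forall y \near x, distinct y -> f x <= f y].

Definition critical_points : set M3 :=
  [set x | distinct x /\ gradient x = 0].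

Definition degenerate_points : set M3 :=
  [set x | critical_points x /\ hessian x \notin unitmx].

End CriticalPoints.

(* Morse index: the largest dimension of a subspace on which the form is
   negative definite.  A subspace is represented by the row space of a matrix. *)
Definition negative_definite_on n (H W : 'M[R]_n) : Prop :=
  forall v : 'rV[R]_n, (v <= W)%MS -> v != 0 -> (v *m H *m v^T) 0 0 < 0.

Definition morse_index n (H : 'M[R]_n) (k : nat) : Prop :=
  (exists2 W : 'M[R]_n, \rank W = k & negative_definite_on H W) /\
  (forall W : 'M[R]_n, negative_definite_on H W -> (\rank W <= k)%N).

Definition saddle_points (f : M3 -> R) : set M3 :=
  [set x | [/\ critical_points f x, hessian f x \in unitmx &
               morse_index (hessian f x) 1]].

Definition aligned x : Prop :=
  collinear (p1 (repr x)) (p2 (repr x)) (p3 (repr x)).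

Definition balanced (qi qj : R) (pi pk pj : 'rV[R]_2) : Prop :=
  strictly_between pi pk pj /\
  eucl_dist pi pk / eucl_dist pk pj = Num.sqrt qi / Num.sqrt qj.

Definition A_1 (q1 q2 q3 : R) : set M3 :=
  [set x | aligned x /\
    balanced q2 q3 (p2 (repr x)) (p1 (repr x)) (p3 (repr x))].
Definition A_2 (q1 q2 q3 : R) : set M3 :=
  [set x | aligned x /\
    balanced q3 q1 (p3 (repr x)) (p2 (repr x)) (p1 (repr x))].
Definition A_3 (q1 q2 q3 : R) : set M3 :=
  [set x | aligned x /\
    balanced q1 q2 (p1 (repr x)) (p3 (repr x)) (p2 (repr x))].

Definition sides_proportional (s1 s2 s3 : R) x : Prop :=
  exists2 c : R, 0 < c & [/\ l1 x = c * s1, l2 x = c * s2 & l3 x = c * s3].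

End Triangles.
Arguments M3 R : clear implicits.
Arguments config R : clear implicits.

(* Main.v *)
Require Import Defs.
From mathcomp Require Import all_boot all_order all_algebra generic_quotient.
From mathcomp Require Import all_classical all_reals all_analysis.
From mathcomp Require Import ring lra.

Import Order.TTheory GRing.Theory Num.Theory.
Import numFieldNormedType.Exports.
Local Open Scope classical_set_scope.
Local Open Scope ring_scope.

Set Implicit Arguments.
Unset Strict Implicit.
Unset Printing Implicit Defensive.

(** Write a triangle, up to similarity, as the complex number
    z = (p_3 - p_1) / (p_2 - p_1).  Its side lengths are then proportional to
    (a, b, 1) with a = |z - 1| and b = |z|.  Put t_k = sqrt (q_i q_j), which is
    proportional to 1 / sqrt q_k.  In the chart z the energy is
      G (a, b) = (1 + a + b) (t_3^2 + t_1^2 / a + t_2^2 / b),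
    that is, the perimeter times the sum of the t_k^2 / l_k.

    Off the real axis, a and b are local coordinates, and G is critical exactly
    when the t_k^2 / l_k^2 are equal, i.e. when (a, b, 1) is proportional to
    (t_1, t_2, t_3) ([shape_criticalP], [critical_off_axis]).  Such a z exists
    iff the t_k satisfy the strict triangle inequalities, and then there are
    two of them, conjugate to each other.  They are global minima by the
    Cauchy-Schwarz inequality ([shape_energy_min_triangle]), and their Hessian
    is positive definite ([triangle_hessian]), so they are not saddles.

    On the real axis the symmetry y -> - y annihilates the y-derivative and the
    mixed second derivative.  On each of the three intervals cut out by the
    collisions z = 0 and z = 1, the energy has a single critical point, which is
    one of the A_k ([critical_on_axis]).  Its second derivative along the axis
    is positive, and the transverse one has the sign of t_k - (t_i + t_j)
    ([axis_critical1], [axis_critical2], [axis_critical3]).  Hence A_k is a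
    saddle iff t_k < t_i + t_j, and it is degenerate in the case of equality.

    A local minimum is critical with a nonnegative second derivative in every
    direction ([local_min_second_order]), which excludes the A_k that are
    saddles.  When t_1 >= t_2 + t_3 the triangle inequality a <= 1 + b alone
    makes A_1 a global minimum ([shape_energy_min_aligned]); this also covers
    the degenerate case, where the second derivatives would not decide.

    The poles are the three collisions, because the side lengths are continuous
    on M(3) ([continuous_sides], [pole_of_short_side]); each collision is a
    single point since two segments of length 1/2 issued from p_1 differ by a
    rotation ([ray_set1]). *)

(** * Second-order condition at a local minimum *)

(** Reduces directional derivatives to derivatives of functions of one real
    variable, for which the mean value theorem and the chain rule are stated. *)
Lemma is_derive_line (R : realType) (V : normedModType R) (f : V -> R)
    (z v : V) (h d : R) :
  is_derive (h *: v + z) v f d <->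
  is_derive h (1 : R) (fun k : R => f (k *: v + z)) d.
Proof.
have E : (fun k : R => k^-1 *: ((f \o shift (h *: v + z)) (k *: v)
                                - f (h *: v + z))) =
         (fun k : R => k^-1 *: (((fun k : R => f (k *: v + z)) \o shift h)
                                  (k *: (1 : R)) - f (h *: v + z))).
  by apply/funext => k /=; rewrite [k *: (1 : R)]mulr1 scalerDl addrA.
split=> -[df <-]; (split; [move: df|]); by rewrite /derivable /derive E.
Qed.

(** Along the line through z of direction v, the first derivative vanishes at an
    interior minimum.  Were the second derivative negative, the first one would
    be negative just after z and the function would decrease. *)
Lemma local_min_second_order (R : realType) (V : normedModType R)
    (f df : V -> R) (z v : V) (d2 : R) :
  (\forall y \near z, f z <= f y) ->
  (\forall y \near z, is_derive y v f (df y)) ->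
  is_derive z v df d2 ->
  df z = 0 /\ 0 <= d2.
Proof.
move=> fmin fdf dfd2.
pose g (h : R) := f (h *: v + z); pose dg (h : R) := df (h *: v + z).
have line_cvg : h *: v + z @[h --> (0 : R)] --> z.
  rewrite -[X in _ --> X]add0r -(scale0r v).
  by apply: cvgD; [apply: cvgZr_tmp; exact: cvg_id | exact: cvg_cst].
have [e /= e0 He] : \forall h \near (0 : R), g 0 <= g h /\ is_derive h (1 : R) g (dg h).
  have h1 : \forall h \near (0 : R), f z <= f (h *: v + z) by exact: line_cvg fmin.
  have h2 : \forall h \near (0 : R), is_derive (h *: v + z) v f (df (h *: v + z)).
    exact: line_cvg fdf.
  have g0 : g 0 = f z by rewrite /g scale0r add0r.
  apply: filterS2 h1 h2 => h hf hdf; rewrite g0; split; first exact: hf.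
  exact: (proj1 (is_derive_line f z v h _) hdf).
have gmin h : `|h| < e -> g 0 <= g h.
  by move=> he; apply: (He h _).1; rewrite /= sub0r normrN.
have gd h : `|h| < e -> is_derive h (1 : R) g (dg h).
  by move=> he; apply: (He h _).2; rewrite /= sub0r normrN.
have d0 : dg 0 = 0.
  have d00 := gd 0 _; rewrite normr0 in d00.
  have [_ <-] := d00 e0.
  apply: (@derive_val _ _ _ _ _ _ _ (@derive1_at_min _ g (- e) e 0 _ _ _ _)).
  - lra.
  - by move=> t; rewrite in_itv /= -ltr_norml => /gd [].
  - by rewrite in_itv /=; lra.
  - by move=> t; rewrite in_itv /= -ltr_norml => /gmin.
split; first by move: d0; rewrite /dg scale0r add0r.
rewrite leNgt; apply/negP => d2n.
have dgd : is_derive (0 : R) (1 : R) dg d2.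
  by apply: (proj1 (is_derive_line df z v 0 d2)); rewrite scale0r add0r.
have : (fun h => h^-1 *: ((dg \o shift 0) (h *: (1 : R)) - dg 0)) @ 0^' --> d2.
  by case: dgd => c <-.
move=> /cvgrPdist_lt /(_ (- d2)); rewrite oppr_gt0 => /(_ d2n) [e' /= e'0 He'].
have dgn h : 0 < h -> h < e' -> dg h < 0.
  move=> h0 he; have := He' h; rewrite /= sub0r normrN gtr0_norm // gt_eqF //.
  move=> /(_ he erefl); rewrite d0 subr0 addr0 [h *: (1 : R)]mulr1.
  have -> : h^-1 *: dg h = h^-1 * dg h by [].
  rewrite ltr_norml => /andP[dh _]; have : h^-1 * dg h < 0 by lra.
  by rewrite pmulr_rlt0 // invr_gt0.
pose m := Num.min e e' / 2.
have m0 : 0 < m by rewrite divr_gt0 // lt_min e0.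
have [me me'] : m < e /\ m < e'.
  have : m < Num.min e e' by rewrite /m ltr_pdivrMr // ltr_pMr ?lt_min ?e0 // ltr1n.
  by rewrite lt_min => /andP[].
have inb t : 0 <= t -> t <= m -> `|t| < e.
  by move=> t0 tm; rewrite ger0_norm // (le_lt_trans tm).
have [c cI] : exists2 c, c \in `]0, m[%R & g m - g 0 = dg c * (m - 0).
  apply: MVT => // [t|].
    by rewrite in_itv /= => /andP[t0 tm]; apply/gd/inb; exact: ltW.
  apply: derivable_within_continuous => t; rewrite in_itv /= => /andP[t0 tm].
  by have [] := gd t (inb _ t0 tm).
move: cI; rewrite in_itv /= => /andP[c0 cm]; rewrite subr0 => E.
have := dgn c c0 (lt_trans cm me').
have := gmin m (inb _ (ltW m0) (lexx _)).
rewrite -subr_ge0 E pmulr_lge0 //; lra.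
Qed.

(** * Binary quadratic forms of index one *)

Lemma quadratic_form2 (R : realType) (H : 'M[R]_2) (v : 'rV[R]_2) :
  H 0 1 = H 1 0 ->
  (v *m H *m v^T) 0 0 =
  H 0 0 * v 0 0 ^+ 2 + 2 * H 0 1 * v 0 0 * v 0 1 + H 1 1 * v 0 1 ^+ 2.
Proof.
move=> sym; rewrite mxE big_ord_recl big_ord1.
rewrite (_ : lift ord0 ord0 = 1 :> 'I_2); last exact: val_inj.
rewrite (_ : ord0 = 0 :> 'I_2); last exact: val_inj.
by rewrite !mulrv0 !mulrv1 !mxE -sym; ring.
Qed.

(** If the form is positive on the first basis vector, its index is at most 1.
    Completing the square, H_00 Q(x, y) = (H_00 x + H_01 y)^2 + det H y^2, so Q
    takes negative values iff the determinant is negative. *)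
Lemma saddle_form2P (R : realType) (H : 'M[R]_2) :
  H 0 1 = H 1 0 -> 0 < H 0 0 ->
  (H \in unitmx /\ morse_index H 1) <-> \det H < 0.
Proof.
move=> sym H00; have detE : \det H = H 0 0 * H 1 1 - H 0 1 ^+ 2.
  by rewrite det_mx22 -sym expr2.
split=> [[_ [[W rW negW] _]]|det0].
- have v0 : nz_row W != 0 by rewrite nz_row_eq0 -mxrank_eq0 rW.
  have := negW _ (nz_row_sub W) v0; rewrite quadratic_form2 // => Q.
  rewrite ltNge; apply/negP => det_ge0.
  set x := nz_row W 0 0 in Q; set y := nz_row W 0 1 in Q.
  have : H 0 0 * (H 0 0 * x ^+ 2 + 2 * H 0 1 * x * y + H 1 1 * y ^+ 2) =
         (H 0 0 * x + H 0 1 * y) ^+ 2 + \det H * y ^+ 2 by rewrite detE; ring.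
  have : 0 <= (H 0 0 * x + H 0 1 * y) ^+ 2 + \det H * y ^+ 2.
    by apply: addr_ge0; [exact: sqr_ge0 | exact: mulr_ge0 (sqr_ge0 _)].
  by move=> + E; rewrite -E pmulr_rge0 // leNgt Q.
- split; first by rewrite unitmxE unitfE lt_eqF.
  (* v annihilates the square H_00 x + H_01 y *)
  pose v : 'rV[R]_2 := vec (- H 0 1) (H 0 0).
  have v0 : v != 0.
    by apply/eqP => /rowP/(_ 1); rewrite vecE1 mxE => /eqP; rewrite gt_eqF.
  split=> [|W negW].
    exists (<<v>>)%MS; first by rewrite mxrank_gen rank_rV v0.
    move=> u; rewrite genmxE => /sub_rVP[a ->]; rewrite scaler_eq0 negb_or.
    case/andP=> a0 _; rewrite quadratic_form2 // [(a *: v) 0 0]mxE [(a *: v) 0 1]mxE.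
    rewrite vecE0 vecE1.
    have -> : H 0 0 * (a * - H 0 1) ^+ 2 + 2 * H 0 1 * (a * - H 0 1) * (a * H 0 0)
        + H 1 1 * (a * H 0 0) ^+ 2 = a ^+ 2 * H 0 0 * \det H.
      by rewrite detE; ring.
    by rewrite pmulr_rlt0 // mulr_gt0 // exprn_even_gt0.
  have := rank_leq_row W; rewrite leq_eqVlt => /orP[fullW|//].
  have := negW (vec 1 0) (submx_full _ fullW).
  rewrite quadratic_form2 // vecE0 vecE1 => /(_ _).
  have e0 : vec 1 0 != 0 :> 'rV[R]_2.
    by apply/eqP => /rowP/(_ 0); rewrite vecE0 mxE => /eqP; rewrite oner_eq0.
  by move=> /(_ e0) neg; exfalso; lra.
Qed.

(** * The Euclidean distance in the plane and its derivative *)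

Definition inner2 {R : realType} (u v : 'rV[R]_2) : R :=
  u 0 0 * v 0 0 + u 0 1 * v 0 1.

Lemma eucl_distC (R : realType) (a b : 'rV[R]_2) : eucl_dist a b = eucl_dist b a.
Proof. by rewrite !eucl_distE -(sqrrN (a 0 0 - _)) -(sqrrN (a 0 1 - _)) !opprB. Qed.

Lemma eucl_dist_ge0 (R : realType) (a b : 'rV[R]_2) : 0 <= eucl_dist a b.
Proof. exact: sqrtr_ge0. Qed.

Lemma eucl_dist_gt0 (R : realType) (a b : 'rV[R]_2) : (0 < eucl_dist a b) = (a != b).
Proof. by rewrite lt_def eucl_dist_eq0 eucl_dist_ge0 andbT. Qed.

Lemma sqr_eucl_dist (R : realType) (p z : 'rV[R]_2) :
  eucl_dist p z ^+ 2 = inner2 (z - p) (z - p).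
Proof.
rewrite eucl_distE sqr_sqrtr ?addr_ge0 ?sqr_ge0 // /inner2 !mxE; ring.
Qed.

(** The rules below are stated for functions written pointwise, so that their
    applications compose into explicit derivation terms. *)
Section ChainRules.
Variables (R : realType) (V : normedModType R) (z v : V).
Implicit Types (f g : V -> R).

Lemma is_derive_funD f g df dg : is_derive z v f df -> is_derive z v g dg ->
  is_derive z v (fun y => f y + g y) (df + dg).
Proof. exact: is_deriveD. Qed.

Lemma is_derive_funM f g df dg : is_derive z v f df -> is_derive z v g dg ->
  is_derive z v (fun y => f y * g y) (df * g z + f z * dg).
Proof.
move=> hf hg; apply: (is_derive_eq (is_deriveM hf hg)).
by rewrite addrC [df * _]mulrC.
Qed.

Lemma is_derive_funV f df : f z != 0 -> is_derive z v f df ->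
  is_derive z v (fun y => (f y)^-1) (- df / f z ^+ 2).
Proof.
move=> f0 [cf <-]; split; first exact: derivableV.
by rewrite deriveV // [_ *: _]mulrC mulrN mulNr.
Qed.

End ChainRules.

Lemma is_derive_coord (R : realType) (z v : 'rV[R]_2) (j : 'I_2) :
  is_derive z v (fun y : 'rV[R]_2 => y 0 j) (v 0 j).
Proof.
rewrite -[z]add0r -(scale0r v); apply/is_derive_line.
have -> : (fun k : R => (k *: v + z) 0 j) = (fun k : R => k * v 0 j + z 0 j).
  by apply/funext => k; rewrite !mxE.
apply: (is_derive_eq (is_derive_funD
  (is_derive_funM (is_derive_id _ _) (is_derive_cst _ _ _)) (is_derive_cst _ _ _))).
by rewrite mul1r mulr0 !addr0.
Qed.

Lemma is_derive_coord_sub (R : realType) (p z v : 'rV[R]_2) (j : 'I_2) :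
  is_derive z v (fun y : 'rV[R]_2 => (y - p) 0 j) (v 0 j).
Proof.
have -> : (fun y : 'rV[R]_2 => (y - p) 0 j) = (fun y => y 0 j + - p 0 j).
  by apply/funext => y; rewrite !mxE.
apply: (is_derive_eq (is_derive_funD (is_derive_coord _ _ _) (is_derive_cst _ _ _))).
by rewrite addr0.
Qed.

Lemma is_derive_eucl_dist (R : realType) (p z v : 'rV[R]_2) : p != z ->
  is_derive z v (eucl_dist p) (inner2 (z - p) v / eucl_dist p z).
Proof.
move=> pz; have r0 : 0 < eucl_dist p z by rewrite eucl_dist_gt0.
pose s (y : 'rV[R]_2) := inner2 (y - p) (y - p).
have sE y : eucl_dist p y = Num.sqrt (s y).
  by rewrite /s -sqr_eucl_dist sqrtr_sqr ger0_norm ?eucl_dist_ge0.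
have sub j := is_derive_coord_sub p z v j.
have ds : is_derive z v s (2 * inner2 (z - p) v).
  apply: (is_derive_eq (is_derive_funD
    (is_derive_funM (sub 0) (sub 0)) (is_derive_funM (sub 1) (sub 1)))).
  by rewrite /inner2; ring.
have s0 : 0 < s z by rewrite /s -sqr_eucl_dist exprn_gt0.
rewrite -[z]add0r -(scale0r v); apply/is_derive_line.
rewrite -[z]add0r -(scale0r v) in ds s0; move/is_derive_line in ds.
have -> : (fun k : R => eucl_dist p (k *: v + z)) =
    Num.sqrt \o (fun k : R => s (k *: v + z)).
  by apply/funext => k /=; rewrite sE.
have := is_derive1_sqrt s0.
move=> /(@is_derive1_comp _ _ (fun k : R => s (k *: v + z)) 0).
move=> /(_ _ ds) H; apply: (is_derive_eq H).
rewrite -sE !scale0r !add0r; field.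
by rewrite gt_eqF.
Qed.

(** * The energy in the chart and its first two derivatives *)

Lemma near_neq (R : realType) (V : normedModType R) (p z : V) :
  p != z -> \forall y \near z, p != y.
Proof.
move=> pz; apply: open_nbhs_nbhs; split=> //.
have -> : (fun y => is_true (p != y)) = ~` [set p].
  by apply/seteqP; split=> y /=; [move=> + e; rewrite e eqxx
                                 | move=> n; apply/eqP => e; exact: n].
apply: closed_openC.
exact: accessible_closed_set1 (hausdorff_accessible (@norm_hausdorff _ _)) _.
Qed.

Section Energy.
Variables (R : realType) (t1 t2 t3 : R).
Implicit Types (a b : R) (z v w : 'rV[R]_2).

(** The energy of a triangle with sides proportional to (a, b, 1) and
    perimeter 1, and below its partial derivatives in a and b. *)
Definition shape_energy a b : R :=
  (1 + a + b) * (t3 ^+ 2 + t1 ^+ 2 / a + t2 ^+ 2 / b).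

Definition shape_da a b : R := t3 ^+ 2 + t2 ^+ 2 / b - t1 ^+ 2 * (1 + b) / a ^+ 2.
Definition shape_db a b : R := t3 ^+ 2 + t1 ^+ 2 / a - t2 ^+ 2 * (1 + a) / b ^+ 2.
Definition shape_daa a b : R := 2 * t1 ^+ 2 * (1 + b) / a ^+ 3.
Definition shape_dab a b : R := - (t1 ^+ 2 / a ^+ 2) - t2 ^+ 2 / b ^+ 2.
Definition shape_dbb a b : R := 2 * t2 ^+ 2 * (1 + a) / b ^+ 3.

Definition energy z : R := shape_energy (eucl_dist (vec 1 0) z) (eucl_dist 0 z).

Section ChainShape.
Variables (V : normedModType R) (y u : V) (f g : V -> R) (df dg : R).
Hypotheses (f0 : f y != 0) (g0 : g y != 0).
Hypotheses (hf : is_derive y u f df) (hg : is_derive y u g dg).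

Let cstD (c : R) : is_derive y u (fun=> c) 0. Proof. exact: is_derive_cst. Qed.
Let hfV := is_derive_funV f0 hf.
Let hgV := is_derive_funV g0 hg.

Lemma is_derive_shape_energy :
  is_derive y u (fun y => shape_energy (f y) (g y))
    (shape_da (f y) (g y) * df + shape_db (f y) (g y) * dg).
Proof.
apply: (is_derive_eq (is_derive_funM
  (is_derive_funD (is_derive_funD (cstD 1) hf) hg)
  (is_derive_funD (is_derive_funD (cstD (t3 ^+ 2)) (is_derive_funM (cstD (t1 ^+ 2)) hfV))
     (is_derive_funM (cstD (t2 ^+ 2)) hgV)))).
by rewrite /shape_da /shape_db; field; rewrite f0 g0.
Qed.

Lemma is_derive_shape_da :
  is_derive y u (fun y => shape_da (f y) (g y))
    (shape_daa (f y) (g y) * df + shape_dab (f y) (g y) * dg).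
Proof.
have -> : (fun y => shape_da (f y) (g y)) = (fun y => t3 ^+ 2 + t2 ^+ 2 * (g y)^-1 +
    - t1 ^+ 2 * (1 + g y) * ((f y)^-1 * (f y)^-1)).
  by apply/funext => x; rewrite /shape_da !mulNr expr2 invfM.
apply: (is_derive_eq (is_derive_funD
  (is_derive_funD (cstD (t3 ^+ 2)) (is_derive_funM (cstD (t2 ^+ 2)) hgV))
  (is_derive_funM (is_derive_funM (cstD (- t1 ^+ 2)) (is_derive_funD (cstD 1) hg))
     (is_derive_funM hfV hfV)))).
by rewrite /shape_daa /shape_dab; field; rewrite f0 g0.
Qed.

Lemma is_derive_shape_db :
  is_derive y u (fun y => shape_db (f y) (g y))
    (shape_dab (f y) (g y) * df + shape_dbb (f y) (g y) * dg).
Proof.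
have -> : (fun y => shape_db (f y) (g y)) = (fun y => t3 ^+ 2 + t1 ^+ 2 * (f y)^-1 +
    - t2 ^+ 2 * (1 + f y) * ((g y)^-1 * (g y)^-1)).
  by apply/funext => x; rewrite /shape_db !mulNr expr2 invfM.
apply: (is_derive_eq (is_derive_funD
  (is_derive_funD (cstD (t3 ^+ 2)) (is_derive_funM (cstD (t1 ^+ 2)) hfV))
  (is_derive_funM (is_derive_funM (cstD (- t2 ^+ 2)) (is_derive_funD (cstD 1) hf))
     (is_derive_funM hgV hgV)))).
by rewrite /shape_dbb /shape_dab; field; rewrite f0 g0.
Qed.

End ChainShape.

(** The derivative at z, in the direction v, of the distance to p. *)
Definition slope p v z : R := inner2 (z - p) v / eucl_dist p z.

Lemma is_derive_slope p v z w : p != z ->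
  is_derive z w (slope p v) ((inner2 w v - slope p v z * slope p w z) / eucl_dist p z).
Proof.
move=> pz; have r0 : eucl_dist p z != 0 by rewrite eucl_dist_eq0.
have sub j := is_derive_coord_sub p z w j.
apply: (is_derive_eq (is_derive_funM
  (is_derive_funD (is_derive_funM (sub 0) (is_derive_cst (v 0 0) _ _))
                  (is_derive_funM (sub 1) (is_derive_cst (v 0 1) _ _)))
  (is_derive_funV r0 (is_derive_eucl_dist w pz)))).
by rewrite /slope /inner2 /=; field.
Qed.

Let p : 'rV[R]_2 := vec 1 0.

(** The chain rule for the shape energy composed with the distances to p and 0
    gives the derivative in the direction v, and then the second derivative in
    the directions v and w. *)
Definition denergy v z : R :=
  let a := eucl_dist p z in let b := eucl_dist 0 z in
  shape_da a b * slope p v z + shape_db a b * slope 0 v z.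

Definition d2energy v w z : R :=
  let a := eucl_dist p z in let b := eucl_dist 0 z in
  (shape_daa a b * slope p w z + shape_dab a b * slope 0 w z) * slope p v z
  + shape_da a b * ((inner2 w v - slope p v z * slope p w z) / a)
  + ((shape_dab a b * slope p w z + shape_dbb a b * slope 0 w z) * slope 0 v z
     + shape_db a b * ((inner2 w v - slope 0 v z * slope 0 w z) / b)).

Lemma is_derive_energy v z : p != z -> 0 != z -> is_derive z v energy (denergy v z).
Proof.
by move=> pz z0; apply: is_derive_shape_energy; rewrite ?eucl_dist_eq0 //;
  exact: is_derive_eucl_dist.
Qed.

Lemma is_derive_denergy v w z : p != z -> 0 != z ->
  is_derive z w (denergy v) (d2energy v w z).
Proof.
move=> pz z0; apply: is_derive_funD; apply: is_derive_funM;
  do ?[exact: is_derive_slope];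
  (apply: is_derive_shape_da || apply: is_derive_shape_db);
  rewrite ?eucl_dist_eq0 //; exact: is_derive_eucl_dist.
Qed.

Lemma derive_energy v z : p != z -> 0 != z -> 'D_v energy z = denergy v z.
Proof. by move=> pz z0; have [_ ->] := is_derive_energy v pz z0. Qed.

Lemma derive2_energy v w z : p != z -> 0 != z ->
  'D_w ('D_v energy) z = d2energy v w z.
Proof.
move=> pz z0; have [_ <-] := is_derive_denergy v w pz z0.
apply: near_eq_derive; apply: filterS2 (near_neq pz) (near_neq z0) => y py y0.
exact: derive_energy.
Qed.

End Energy.

(** * Critical points of the energy *)

Section CriticalPoints.
Variables (R : realType) (t1 t2 t3 : R).
Hypotheses (t1_gt0 : 0 < t1) (t2_gt0 : 0 < t2) (t3_gt0 : 0 < t3).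
Implicit Types (a b x y : R) (z : 'rV[R]_2).

Local Notation p := (vec 1 0 : 'rV[R]_2).
Local Notation e0 := (delta_mx 0 0 : 'rV[R]_2).
Local Notation e1 := (delta_mx 0 1 : 'rV[R]_2).
Local Notation da := (shape_da t1 t2 t3).
Local Notation db := (shape_db t1 t2 t3).
Local Notation daa := (shape_daa t1).
Local Notation dab := (shape_dab t1 t2).
Local Notation dbb := (shape_dbb t2).

(** With m = t_1^2 / a^2 and n = t_2^2 / b^2, the difference of the two equations
    is (m - n) (1 + a + b) = 0, and then either one gives m = n = t_3^2. *)
Lemma shape_criticalP a b : 0 < a -> 0 < b ->
  (da a b = 0 /\ db a b = 0) <-> (a = t1 / t3 /\ b = t2 / t3).
Proof.
move=> a0 b0; have t30 := gt_eqF t3_gt0.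
split=> [[ea eb]|[-> ->]]; last first.
  by split; rewrite /shape_da /shape_db; field; rewrite ?gt_eqF.
pose m := t1 ^+ 2 / a ^+ 2; pose n := t2 ^+ 2 / b ^+ 2.
have ea' : t3 ^+ 2 + n * b - m * (1 + b) = 0.
  by rewrite -ea /shape_da /m /n; field; rewrite ?gt_eqF.
have eb' : t3 ^+ 2 + m * a - n * (1 + a) = 0.
  by rewrite -eb /shape_db /m /n; field; rewrite ?gt_eqF.
have mn : m = n.
  have /eqP : (m - n) * (1 + a + b) = 0.
    transitivity ((t3 ^+ 2 + m * a - n * (1 + a)) - (t3 ^+ 2 + n * b - m * (1 + b))).
      by ring.
    by rewrite ea' eb' subrr.
  by rewrite mulf_eq0 subr_eq0 [1 + a + b == 0]gt_eqF ?orbF; [move/eqP | lra].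
have m3 : m = t3 ^+ 2 by move: ea'; rewrite -mn; lra.
have n3 : n = t3 ^+ 2 by rewrite -mn.
have root (t c : R) : 0 < t -> 0 < c -> t ^+ 2 / c ^+ 2 = t3 ^+ 2 -> c = t / t3.
  move=> tgt cgt; rewrite -expr_div_n => /eqP.
  rewrite eqrXn2 // ?divr_ge0 ?ltW // => /eqP <-.
  by field; rewrite ?gt_eqF.
by split; apply: root.
Qed.

Lemma slope_vec (c x y : R) (v : 'rV[R]_2) :
  slope (vec c 0) v (vec x y) =
  ((x - c) * v 0 0 + y * v 0 1) / eucl_dist (vec c 0) (vec x y).
Proof. by rewrite /slope /inner2 !mxE /= subr0. Qed.

Lemma vec00 : vec 0 0 = 0 :> 'rV[R]_2.
Proof. by apply: vecP; rewrite !mxE. Qed.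

Lemma vec_eta z : z = vec (z 0 0) (z 0 1).
Proof. by apply: vecP; rewrite !mxE. Qed.

Lemma eucl_dist_line (c x : R) : eucl_dist (vec c 0) (vec x 0) = `|x - c|.
Proof. by rewrite eucl_distC eucl_distE !mxE /= subrr expr0n addr0 sqrtr_sqr. Qed.

Lemma denergy_e0 x y :
  let z := vec x y in let a := eucl_dist p z in let b := eucl_dist 0 z in
  denergy t1 t2 t3 e0 z = da a b * ((x - 1) / a) + db a b * (x / b).
Proof.
rewrite /denergy /= -vec00 !slope_vec !mxE /=.
by rewrite !mulr0 !mulr1 !addr0 subr0.
Qed.

Lemma denergy_e1 x y :
  let z := vec x y in let a := eucl_dist p z in let b := eucl_dist 0 z in
  denergy t1 t2 t3 e1 z = y * (da a b / a + db a b / b).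
Proof.
rewrite /denergy /= -vec00 !slope_vec !mxE /=.
by rewrite !mulr0 !mulr1 !add0r; ring.
Qed.

(** The abscissa of p_3 in the aligned configuration A_k, when p_1 and p_2 are
    placed at 0 and 1. *)
Definition ratio1 : R := - (t2 / t3).
Definition ratio2 : R := 1 + t1 / t3.
Definition ratio3 : R := t2 / (t1 + t2).

Definition nondegenerate_triangle z : Prop :=
  [/\ z 0 1 != 0, eucl_dist p z = t1 / t3 & eucl_dist 0 z = t2 / t3].

(** On each interval the condition reduces, after clearing denominators, to the
    equality of two squares of positive quotients.  For instance on (0, 1) it is
    t_1^2 / (1 - x)^2 = t_2^2 / x^2, which has the only root t_2 / (t_1 + t_2). *)
Lemma critical_on_axis x : x != 1 -> x != 0 ->
  denergy t1 t2 t3 e0 (vec x 0) = 0 -> [\/ x = ratio1, x = ratio2 | x = ratio3].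
Proof.
move=> x1 x0; rewrite denergy_e0 -vec00 !eucl_dist_line subr0.
have root (s r c d : R) : 0 < s -> 0 < r -> 0 < c -> 0 < d ->
    s ^+ 2 / c ^+ 2 = r ^+ 2 / d ^+ 2 -> s * d = r * c.
  move=> s0 r0 c0 d0; rewrite -!expr_div_n => /eqP.
  rewrite eqrXn2 // ?divr_ge0 ?ltW // => /eqP E.
  have -> : s * d = s / c * (c * d) by field; rewrite gt_eqF.
  by rewrite E; field; rewrite gt_eqF.
rewrite /shape_da /shape_db.
have [xneg|xpos|] := ltrgtP x 0; last by move/eqP: x0.
- have -> : `|x - 1| = 1 - x by rewrite ltr0_norm; lra.
  rewrite (ltr0_norm xneg).
  move=> E; apply: Or31.
  have xn0 : 1 - x != 0 by rewrite subr_eq0 eq_sym.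
  have : t3 * - x = t2 * 1.
    apply: root => //; first by lra.
    rewrite expr1n divr1; apply/eqP; rewrite -subr_eq0; apply/eqP.
    apply: (mulfI (x := 2)); first by [].
    rewrite mulr0 -[RHS]oppr0 -E; field.
    by rewrite x0 xn0.
  rewrite /ratio1 => h; apply: (mulfI (lt0r_neq0 t3_gt0)).
  by rewrite mulrN mulrCA divff ?gt_eqF //; lra.
- have [xlt|xgt|] := ltrgtP x 1; last by move/eqP: x1.
  + rewrite (gtr0_norm xpos).
    move=> E; apply: Or33.
    have xn0 : 1 - x != 0 by rewrite subr_eq0 eq_sym.
    have : t1 * x = t2 * (1 - x).
      apply: root => //; first by lra.
      apply/eqP; rewrite -subr_eq0; apply/eqP.
      apply: (mulfI (x := 2)); first by [].
      rewrite mulr0 -[RHS]E; field.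
      by rewrite x0 xn0.
    rewrite /ratio3 => h; have t12 : t1 + t2 != 0 by rewrite gt_eqF ?addr_gt0.
    by apply: (mulfI t12); rewrite mulrCA divff // mulrDl h; ring.
  + rewrite (gtr0_norm xpos).
    move=> E; apply: Or32.
    have xn0 : x - 1 != 0 by rewrite subr_eq0.
    have : t3 * (x - 1) = t1 * 1.
      apply: root => //; first by lra.
      rewrite expr1n divr1; apply/eqP; rewrite -subr_eq0; apply/eqP.
      apply: (mulfI (x := 2)); first by [].
      rewrite mulr0 -[RHS]E; field.
      by rewrite x0 xn0.
    rewrite /ratio2 => h; apply: (mulfI (lt0r_neq0 t3_gt0)).
    by rewrite mulrDr mulrCA divff ?gt_eqF //; lra.
Qed.

(** When y is nonzero, the derivative in y gives da / a + db / b = 0, and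
    subtracting the derivative in x from x times this leaves da / a = 0. *)
Lemma critical_off_axis z : p != z -> 0 != z -> z 0 1 != 0 ->
  denergy t1 t2 t3 e0 z = 0 -> denergy t1 t2 t3 e1 z = 0 ->
  nondegenerate_triangle z.
Proof.
move=> pz z0; rewrite [z]vec_eta vecE1 => y0; rewrite denergy_e0 denergy_e1.
rewrite -vec_eta; set x := z 0 0; set y := z 0 1 in y0 *.
have a0 : 0 < eucl_dist p z by rewrite eucl_dist_gt0.
have b0 : 0 < eucl_dist 0 z by rewrite eucl_dist_gt0.
set a := eucl_dist p z in a0 *; set b := eucl_dist 0 z in b0 *.
move=> E0 /eqP; rewrite mulf_eq0 (negPf y0) /= => /eqP E1.
have Ea : da a b / a = 0.
  transitivity (x * (da a b / a + db a b / b) - (da a b * ((x - 1) / a) + db a b * (x / b))).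
    by field; rewrite !gt_eqF.
  by rewrite E0 E1 mulr0 subrr.
have Eb : db a b / b = 0 by rewrite -[LHS]add0r -[X in X + _]Ea.
have [|ha hb] := (shape_criticalP a0 b0).1.
- split; apply/eqP.
    by move/eqP: Ea; rewrite mulf_eq0 invr_eq0 (gt_eqF a0) orbF.
  by move/eqP: Eb; rewrite mulf_eq0 invr_eq0 (gt_eqF b0) orbF.
by split.
Qed.

Lemma critical_cases z : p != z -> 0 != z ->
  denergy t1 t2 t3 e0 z = 0 -> denergy t1 t2 t3 e1 z = 0 ->
  [\/ z = vec ratio1 0, z = vec ratio2 0, z = vec ratio3 0 | nondegenerate_triangle z].
Proof.
move=> pz z0 E0 E1; have [y0|y0] := eqVneq (z 0 1) 0; last first.
  exact/Or44/critical_off_axis.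
move: pz z0 E0; rewrite [z]vec_eta y0 => pz z0 /critical_on_axis h.
have [||->|->|->] := h.
- by apply: contra_neq pz => ->.
- by apply: contra_neq z0 => ->; rewrite vec00.
- exact: Or41.
- exact: Or42.
- exact: Or43.
Qed.

(** The three points z, 0 and 1 are not aligned, so |x| < b, from which the
    inequalities follow by expanding a^2 = b^2 - 2 x + 1. *)
Lemma triangle_ineq_strict z : nondegenerate_triangle z ->
  [/\ t1 < t2 + t3, t2 < t3 + t1 & t3 < t1 + t2].
Proof.
move=> [y0 ea eb].
have sa : (z 0 0 - 1) ^+ 2 + z 0 1 ^+ 2 = (t1 / t3) ^+ 2.
  by rewrite -ea sqr_eucl_dist /inner2 !mxE /=; ring.
have sb : z 0 0 ^+ 2 + z 0 1 ^+ 2 = (t2 / t3) ^+ 2.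
  by rewrite -eb sqr_eucl_dist /inner2 !mxE /=; ring.
have y2 : 0 < z 0 1 ^+ 2 by rewrite exprn_even_gt0.
have a0 : 0 < t1 / t3 by rewrite divr_gt0.
have b0 : 0 < t2 / t3 by rewrite divr_gt0.
have E1 : t1 / t3 * t3 = t1 by rewrite divfK ?gt_eqF.
have E2 : t2 / t3 * t3 = t2 by rewrite divfK ?gt_eqF.
move: sa sb a0 b0 y2 E1 E2; set x := z 0 0; set a := t1 / t3; set b := t2 / t3.
set y := z 0 1 ^+ 2 => sa sb a0 b0 y2 E1 E2.
have bx : x < b by rewrite ltNge; apply/negP => h; nra.
have bx' : - b < x by rewrite ltNge; apply/negP => h; nra.
have h1 : a < b + 1 by rewrite ltNge; apply/negP => h; nra.
have h2 : b < 1 + a by rewrite ltNge; apply/negP => h; nra.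
have h3 : 1 < a + b by rewrite ltNge; apply/negP => h; nra.
move: h1 h2 h3; rewrite -(ltr_pM2r t3_gt0 a) -(ltr_pM2r t3_gt0 b) -(ltr_pM2r t3_gt0 1).
by rewrite !mulrDl E1 E2 mul1r => ? ? ?; split; lra.
Qed.

End CriticalPoints.

(** * Hessians at the critical points *)

Section Hessian.
Variables (R : realType) (t1 t2 t3 : R).
Hypotheses (t1_gt0 : 0 < t1) (t2_gt0 : 0 < t2) (t3_gt0 : 0 < t3).
Implicit Types (a b x y : R) (z : 'rV[R]_2).

Local Notation p := (vec 1 0 : 'rV[R]_2).
Local Notation e0 := (delta_mx 0 0 : 'rV[R]_2).
Local Notation e1 := (delta_mx 0 1 : 'rV[R]_2).
Local Notation D := (denergy t1 t2 t3).
Local Notation D2 := (d2energy t1 t2 t3).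
Local Notation da := (shape_da t1 t2 t3).
Local Notation db := (shape_db t1 t2 t3).
Local Notation daa := (shape_daa t1).
Local Notation dab := (shape_dab t1 t2).
Local Notation dbb := (shape_dbb t2).

Lemma inner2_e (i j : 'I_2) :
  inner2 (delta_mx 0 i : 'rV[R]_2) (delta_mx 0 j) = (i == j)%:R.
Proof.
rewrite /inner2 !mxE /=.
by case: i j => -[|[|//]] ? [[|[|//]] ?] /=; rewrite !(mulr0, mulr1, mul0r, addr0, add0r).
Qed.

(** A critical point with diagonal Hessian, convex along the axis; the sign of d
    decides between saddle, degenerate point and minimum. *)
Definition axis_critical z (d : R) : Prop :=
  [/\ p != z, 0 != z, D e0 z = 0, D e1 z = 0 &
  [/\ 0 < D2 e0 e0 z, D2 e0 e1 z = 0, D2 e1 e0 z = 0 &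
      exists2 c, 0 < c & D2 e1 e1 z = c * d]].

(** At (x, 0) the gradients of the distances to 1 and 0 are (sa, 0) and (sb, 0)
    with signs sa and sb.  Near x the distances are therefore affine along the
    axis, while their transverse second derivatives are 1/a and 1/b. *)
Lemma axis_criticalP x a b (sa sb d : R) :
  0 < a -> 0 < b -> sa ^+ 2 = 1 -> sb ^+ 2 = 1 -> x - 1 = sa * a -> x = sb * b ->
  da a b * sa + db a b * sb = 0 ->
  0 < daa a b + 2 * dab a b * (sa * sb) + dbb a b ->
  (exists2 c, 0 < c & da a b / a + db a b / b = c * d) ->
  axis_critical (vec x 0) d.
Proof.
move=> a0 b0 sa2 sb2 ea eb crit pos dyy.
have da_ : eucl_dist p (vec x 0) = a.
  by rewrite eucl_dist_line ea -sqrtr_sqr exprMn sa2 mul1r sqrtr_sqr gtr0_norm.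
have db_ : eucl_dist 0 (vec x 0) = b.
  by rewrite -(vec00 R) eucl_dist_line subr0 eb -sqrtr_sqr exprMn sb2 mul1r sqrtr_sqr gtr0_norm.
have pz : p != vec x 0 by rewrite -eucl_dist_gt0 da_.
have z0 : 0 != vec x 0 by rewrite -eucl_dist_gt0 db_.
have sa0 : slope p e0 (vec x 0) = sa.
  by rewrite slope_vec da_ !mxE /= mulr1 mulr0 addr0 ea mulfK ?gt_eqF.
have sa1 : slope p e1 (vec x 0) = 0.
  by rewrite slope_vec !mxE /= mulr0 mul0r addr0 mul0r.
have sb0 : slope 0 e0 (vec x 0) = sb.
  by rewrite -(vec00 R) slope_vec (vec00 R) db_ !mxE /= subr0 mulr1 mulr0 addr0 eb mulfK ?gt_eqF.
have sb1 : slope 0 e1 (vec x 0) = 0.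
  by rewrite -(vec00 R) slope_vec !mxE /= mulr0 mul0r addr0 mul0r.
split=> //; first by rewrite /denergy da_ db_ sa0 sb0.
  by rewrite /denergy da_ db_ sa1 sb1 !mulr0 addr0.
rewrite /d2energy da_ db_ sa0 sb0 sa1 sb1 !inner2_e !mulr0 !mul0r !subr0 /= !mul0r !mulr0.
rewrite !addr0 !add0r; split; last first.
- by case: dyy => c c0 E; exists c => //; rewrite -E !div1r.
- by rewrite ?mul0r ?addr0.
- by rewrite ?mul0r ?addr0.
rewrite -!expr2 sa2 sb2 !subrr !mul0r !mulr0 !addr0.
move: pos; congr (_ < _).
transitivity (daa a b * sa ^+ 2 + 2 * dab a b * (sa * sb) + dbb a b * sb ^+ 2).
  by rewrite sa2 sb2 !mulr1.
by ring.
Qed.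

(** In the three lemmas below the transverse second derivative is a positive
    factor times t_k^2 - (t_i + t_j)^2. *)
Lemma axis_critical1 : axis_critical (vec (ratio1 t2 t3) 0) (t1 - (t2 + t3)).
Proof.
have n2 : t2 != 0 by rewrite gt_eqF.
have n3 : t3 != 0 by rewrite gt_eqF.
have n23 : t2 + t3 != 0 by rewrite gt_eqF ?addr_gt0.
rewrite /ratio1.
apply: (@axis_criticalP _ ((t2 + t3) / t3) (t2 / t3) (-1) (-1)).
- by rewrite divr_gt0 ?addr_gt0.
- by rewrite divr_gt0.
- by rewrite sqrrN expr1n.
- by rewrite sqrrN expr1n.
- by field.
- by field.
- by rewrite /shape_da /shape_db; field; rewrite n2 n23 n3.
- have -> : daa ((t2 + t3) / t3) (t2 / t3) + 2 * dab ((t2 + t3) / t3) (t2 / t3) * (-1 * -1)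
      + dbb ((t2 + t3) / t3) (t2 / t3) = 4 * t3 ^+ 3 / t2.
    by rewrite /shape_daa /shape_dab /shape_dbb; field; rewrite n2 n23 n3.
  by rewrite divr_gt0 ?mulr_gt0 ?exprn_gt0.
- exists (t3 ^+ 3 * (t1 + (t2 + t3)) / ((t2 + t3) ^+ 2 * t2)).
    by rewrite divr_gt0 ?mulr_gt0 ?exprn_gt0 ?addr_gt0.
  by rewrite /shape_da /shape_db; field; rewrite n2 n23 n3.
Qed.

Lemma axis_critical2 : axis_critical (vec (ratio2 t1 t3) 0) (t2 - (t3 + t1)).
Proof.
have n1 : t1 != 0 by rewrite gt_eqF.
have n3 : t3 != 0 by rewrite gt_eqF.
have n31 : t3 + t1 != 0 by rewrite gt_eqF ?addr_gt0.
rewrite /ratio2.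
apply: (@axis_criticalP _ (t1 / t3) ((t3 + t1) / t3) 1 1).
- by rewrite divr_gt0.
- by rewrite divr_gt0 ?addr_gt0.
- by rewrite expr1n.
- by rewrite expr1n.
- by field.
- by field.
- by rewrite /shape_da /shape_db; field; rewrite n1 n31 n3.
- have -> : daa (t1 / t3) ((t3 + t1) / t3) + 2 * dab (t1 / t3) ((t3 + t1) / t3) * (1 * 1)
      + dbb (t1 / t3) ((t3 + t1) / t3) = 4 * t3 ^+ 3 / t1.
    by rewrite /shape_daa /shape_dab /shape_dbb; field; rewrite n1 n31 n3.
  by rewrite divr_gt0 ?mulr_gt0 ?exprn_gt0.
- exists (t3 ^+ 3 * (t2 + (t3 + t1)) / ((t3 + t1) ^+ 2 * t1)).
    by rewrite divr_gt0 ?mulr_gt0 ?exprn_gt0 ?addr_gt0.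
  by rewrite /shape_da /shape_db; field; rewrite n1 n31 n3.
Qed.

Lemma axis_critical3 : axis_critical (vec (ratio3 t1 t2) 0) (t3 - (t1 + t2)).
Proof.
have n1 : t1 != 0 by rewrite gt_eqF.
have n2 : t2 != 0 by rewrite gt_eqF.
have n12 : t1 + t2 != 0 by rewrite gt_eqF ?addr_gt0.
rewrite /ratio3.
apply: (@axis_criticalP _ (t1 / (t1 + t2)) (t2 / (t1 + t2)) (-1) 1).
- by rewrite divr_gt0 ?addr_gt0.
- by rewrite divr_gt0 ?addr_gt0.
- by rewrite sqrrN expr1n.
- by rewrite expr1n.
- by field.
- by field.
- by rewrite /shape_da /shape_db; field; rewrite n1 n2 n12.
- have a0 : 0 < t1 / (t1 + t2) by rewrite divr_gt0 ?addr_gt0.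
  have b0 : 0 < t2 / (t1 + t2) by rewrite divr_gt0 ?addr_gt0.
  rewrite /shape_daa /shape_dab /shape_dbb mulr1 mulrN1 -!opprD mulrN opprK.
  by do ?[apply: addr_gt0 | apply: divr_gt0 | apply: mulr_gt0 | apply: exprn_gt0 | done].
- exists ((t3 + (t1 + t2)) * (t1 + t2) ^+ 2 / (t1 * t2)).
    by rewrite divr_gt0 ?mulr_gt0 ?exprn_gt0 ?addr_gt0.
  by rewrite /shape_da /shape_db; field; rewrite n1 n2 n12.
Qed.

(** The Hessian is J^T S J, where S is the Hessian of the shape energy in (a, b),
    positive definite at its critical point, and J is the Jacobian of (a, b),
    whose determinant is - y / (a b). *)
Lemma triangle_hessian z : nondegenerate_triangle t1 t2 t3 z ->
  [/\ 0 < D2 e0 e0 z, D2 e0 e1 z = D2 e1 e0 z &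
      0 < D2 e0 e0 z * D2 e1 e1 z - D2 e0 e1 z ^+ 2].
Proof.
move=> [y0 ea eb].
have a0 : 0 < t1 / t3 by rewrite divr_gt0.
have b0 : 0 < t2 / t3 by rewrite divr_gt0.
have [da0 db0] := (shape_criticalP t1_gt0 t2_gt0 t3_gt0 a0 b0).2 (conj erefl erefl).
rewrite /d2energy ea eb da0 db0 !mul0r !addr0.
set u0 := slope p e0 z; set u1 := slope p e1 z.
set w0 := slope 0 e0 z; set w1 := slope 0 e1 z.
(* u and w are the rows of the Jacobian J *)
have det_uw : u0 * w1 - u1 * w0 != 0.
  rewrite /u0 /u1 /w0 /w1 [z]vec_eta -(vec00 R) !slope_vec -vec_eta (vec00 R) ea eb !mxE /=.
  have -> : forall x y, ((x - 1) * 1 + y * 0) / (t1 / t3) * (((x - 0) * 0 + y * 1) / (t2 / t3))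
    - ((x - 1) * 0 + y * 1) / (t1 / t3) * (((x - 0) * 1 + y * 0) / (t2 / t3))
    = - y / (t1 / t3) / (t2 / t3).
    by move=> x y; field; rewrite !gt_eqF.
  by rewrite !mulf_neq0 ?oppr_eq0 // invr_neq0 // gt_eqF.
set A := daa _ _; set B := dab _ _; set C := dbb _ _.
have A0 : 0 < A.
  by rewrite /A /shape_daa; apply: divr_gt0; rewrite ?exprn_gt0 // !mulr_gt0 ?exprn_gt0 // addr_gt0.
have disc : 0 < A * C - B ^+ 2.
  have -> : A * C - B ^+ 2 = 4 * t3 ^+ 5 * (t1 + t2 + t3) / (t1 * t2).
    by rewrite /A /B /C /shape_daa /shape_dab /shape_dbb; field; rewrite !gt_eqF.
  by rewrite divr_gt0 ?mulr_gt0 ?exprn_gt0 ?addr_gt0.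
split.
- rewrite -(pmulr_rgt0 _ A0).
  have -> : A * ((A * u0 + B * w0) * u0 + (B * u0 + C * w0) * w0) =
     (A * u0 + B * w0) ^+ 2 + (A * C - B ^+ 2) * w0 ^+ 2 by ring.
  have [w00|w00] := eqVneq w0 0; last first.
    by rewrite ltr_wpDl ?sqr_ge0 // mulr_gt0 // exprn_even_gt0.
  have u00 : u0 != 0 by apply: contra_neq det_uw => ->; rewrite w00; ring.
  rewrite w00 expr0n /= !mulr0 !addr0 exprn_even_gt0 //= mulf_neq0 // gt_eqF //.
- by ring.
- have -> : ((A * u0 + B * w0) * u0 + (B * u0 + C * w0) * w0) *
     ((A * u1 + B * w1) * u1 + (B * u1 + C * w1) * w1) -
     ((A * u1 + B * w1) * u0 + (B * u1 + C * w1) * w0) ^+ 2 =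
     (A * C - B ^+ 2) * (u0 * w1 - u1 * w0) ^+ 2 by ring.
  by rewrite mulr_gt0 // exprn_even_gt0.
Qed.

End Hessian.

(** * Global lower bounds for the energy *)

Section GlobalMinimum.
Variables (R : realType) (t1 t2 t3 : R).
Hypotheses (t1_gt0 : 0 < t1) (t2_gt0 : 0 < t2) (t3_gt0 : 0 < t3).
Implicit Types (a b x y : R) (z : 'rV[R]_2).

Local Notation E := (shape_energy t1 t2 t3).

(** Cauchy-Schwarz for (1, a, b) and (t_3^2, t_1^2 / a, t_2^2 / b), with the
    defect written as a sum of squares. *)
Lemma shape_energy_min_triangle a b : 0 < a -> 0 < b ->
  E (t1 / t3) (t2 / t3) <= E a b.
Proof.
move=> a0 b0.
have -> : E (t1 / t3) (t2 / t3) = (t1 + t2 + t3) ^+ 2.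
  by rewrite /shape_energy; field; rewrite !gt_eqF.
rewrite -subr_ge0.
have -> : E a b - (t1 + t2 + t3) ^+ 2 =
   (t1 - t3 * a) ^+ 2 / a + (t2 - t3 * b) ^+ 2 / b + (t1 * b - t2 * a) ^+ 2 / (a * b).
  by rewrite /shape_energy; field; rewrite !gt_eqF.
by apply: addr_ge0; [apply: addr_ge0|]; apply: divr_ge0;
  rewrite ?sqr_ge0 ?mulr_ge0 ?ltW.
Qed.

(** Cauchy-Schwarz replaces t_3^2 + t_2^2 / b by (t_2 + t_3)^2 / (1 + b).  There
    remains the problem with two sides a <= m = 1 + b and weights
    t_1 >= t_2 + t_3, where the constraint is active: the minimum is at a = m. *)
Lemma shape_energy_min_aligned a b : 0 < a -> 0 < b -> a <= 1 + b ->
  t2 + t3 <= t1 -> E (1 + t2 / t3) (t2 / t3) <= E a b.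
Proof.
move=> a0 b0 ab t1_ge.
have -> : E (1 + t2 / t3) (t2 / t3) = 2 * (t1 ^+ 2 + (t2 + t3) ^+ 2).
  by rewrite /shape_energy; field; rewrite !gt_eqF ?addr_gt0.
have m0 : 0 < 1 + b by lra.
rewrite -subr_ge0.
have -> : E a b - 2 * (t1 ^+ 2 + (t2 + t3) ^+ 2) =
   (1 + a + b) * (t2 - t3 * b) ^+ 2 / (b * (1 + b)) +
   (1 + b - a) * (t1 ^+ 2 * (1 + b) - (t2 + t3) ^+ 2 * a) / (a * (1 + b)).
  by rewrite /shape_energy; field; rewrite !gt_eqF.
apply: addr_ge0; apply: divr_ge0; try by apply: mulr_ge0; lra.
- by apply: mulr_ge0; [lra | exact: sqr_ge0].
- apply: mulr_ge0; first by lra.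
  rewrite subr_ge0; apply: ler_pM => //; try exact: sqr_ge0; try exact: ltW.
  apply: lerXn2r => //; rewrite nnegrE; [apply: addr_ge0|]; exact: ltW.
Qed.

Lemma eucl_dist_triangle_p z : eucl_dist (vec 1 0) z <= 1 + eucl_dist 0 z.
Proof.
have h := @eucl_dist_ge0 R 0 z.
rewrite -(ler_pXn2r (n := 2)) ?nnegrE ?eucl_dist_ge0 ?addr_ge0 //.
have b2 : eucl_dist 0 z ^+ 2 = z 0 0 ^+ 2 + z 0 1 ^+ 2.
  by rewrite sqr_eucl_dist /inner2 !mxE; ring.
rewrite sqr_eucl_dist /inner2 !mxE /=; move: h b2; set b := eucl_dist 0 z.
set x := z 0 0; set y := z 0 1 => h b2.
have : - b <= x by rewrite leNgt; apply/negP => lt; nra.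
nra.
Qed.

End GlobalMinimum.

(** * Side lengths and chart on the space of triangles *)

Section ChartOfM3.
Local Open Scope quotient_scope.
Variable R : realType.
Implicit Types (x y : M3 R) (z : 'rV[R]_2) (P Q : config R).

Local Notation p := (vec 1 0 : 'rV[R]_2).

Lemma eucl_dist0p : eucl_dist 0 p = 1.
Proof. by rewrite eucl_distE !mxE /= !sub0r sqrrN expr1n oppr0 expr0n addr0 sqrtr1. Qed.

Lemma l1_chart_inv z : l1 (chart_inv z) = chart_scale z * eucl_dist p z.
Proof. by rewrite l1_pi p2_chart_inv p3_chart_inv eucl_distZ // ltW ?chart_scale_gt0. Qed.

Lemma l2_chart_inv z : l2 (chart_inv z) = chart_scale z * eucl_dist 0 z.
Proof.
rewrite l2_pi p3_chart_inv p1_chart_inv -{1}(scaler0 _ (chart_scale z)).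
by rewrite eucl_distZ ?(ltW (chart_scale_gt0 _)) // eucl_distC.
Qed.

Lemma l3_chart_inv z : l3 (chart_inv z) = chart_scale z.
Proof.
rewrite l3_pi p2_chart_inv p1_chart_inv -{1}(scaler0 _ (chart_scale z)).
by rewrite eucl_distZ ?(ltW (chart_scale_gt0 _)) // eucl_dist0p mulr1.
Qed.

Lemma coulomb_chart_inv (q1 q2 q3 t1 t2 t3 : R) z :
  t1 ^+ 2 = q2 * q3 -> t2 ^+ 2 = q3 * q1 -> t3 ^+ 2 = q1 * q2 ->
  coulomb q1 q2 q3 (chart_inv z) = energy t1 t2 t3 z.
Proof.
move=> h1 h2 h3; rewrite /coulomb l1_chart_inv l2_chart_inv l3_chart_inv.
rewrite /energy /shape_energy h1 h2 h3 !invfM /chart_scale invrK.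
by rewrite [eucl_dist z 0]eucl_distC; ring.
Qed.

Lemma continuous_eucl_dist (T : topologicalType) (f g : T -> 'rV[R]_2) :
  continuous f -> continuous g -> continuous (fun u => eucl_dist (f u) (g u)).
Proof.
move=> cf cg; have -> : (fun u => eucl_dist (f u) (g u)) =
    Num.sqrt \o (fun u => (f u 0 0 - g u 0 0) ^+ 2 + (f u 0 1 - g u 0 1) ^+ 2).
  by apply/funext => u /=; rewrite eucl_distE.
have coord (h : T -> 'rV[R]_2) (j : 'I_2) : continuous h -> continuous (fun u => h u 0 j).
  move=> ch u; apply: (@continuous_comp _ _ _ h (fun v : 'rV[R]_2 => v 0 j)).
    exact: ch.
  exact: coord_continuous.
have sqr (j : 'I_2) : continuous (fun u => (f u 0 j - g u 0 j) ^+ 2).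
  move=> u; apply: (@continuous_comp _ _ _ (fun u => f u 0 j - g u 0 j) (fun s : R => s ^+ 2)).
    by apply: cvgB; exact: coord.
  exact: exprn_continuous.
move=> u; apply: continuous_comp; last exact: sqrt_continuous.
by apply: cvgD; exact: sqr.
Qed.

Lemma continuous_compT (S T U : topologicalType) (f : S -> T) (g : T -> U) :
  continuous f -> continuous g -> continuous (g \o f).
Proof. by move=> cf cg x; apply: continuous_comp; [exact: cf | exact: cg]. Qed.

Lemma continuous_sides :
  [/\ continuous (@l1 R), continuous (@l2 R) & continuous (@l3 R)].
Proof.
have cval : continuous (set_val : config R -> _) by exact: initial_continuous.
have cfst (U V : topologicalType) : continuous (@fst U V).
  by move=> [u v]; exact: (@cvg_fst _ _ (nbhs u) (nbhs v)).
have csnd (U V : topologicalType) : continuous (@snd U V).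
  by move=> [u v]; exact: (@cvg_snd _ _ (nbhs u) (nbhs v)).
have c2 : continuous (@p2 R).
  have h := continuous_compT (continuous_compT cval (@cfst _ _)) (@csnd _ _).
  by have -> : @p2 R = snd \o (fst \o set_val) by [].
have c1 : continuous (@p1 R).
  have -> : @p1 R = (fun=> 0) by apply/funext => P; exact: p1_eq0.
  exact: cst_continuous.
have c3 : continuous (@p3 R).
  by have h := continuous_compT cval (@csnd _ _).
split; apply/quotient_continuous.
- have -> : (@l1 R) \o \pi_(M3 R) = (fun P => eucl_dist (p2 P) (p3 P)).
    by apply/funext => P /=; exact: l1_pi.
  exact: (continuous_eucl_dist c2 c3).
- have -> : (@l2 R) \o \pi_(M3 R) = (fun P => eucl_dist (p3 P) (p1 P)).
    by apply/funext => P /=; exact: l2_pi.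
  exact: (continuous_eucl_dist c3 c1).
- have -> : (@l3 R) \o \pi_(M3 R) = (fun P => eucl_dist (p1 P) (p2 P)).
    by apply/funext => P /=; exact: l3_pi.
  exact: (continuous_eucl_dist c1 c2).
Qed.

(** Transfers local minimality from M(3), with its quotient topology, to the
    chart. *)
Lemma continuous_chart_inv : continuous (@chart_inv R).
Proof.
have cs : continuous (@chart_scale R).
  move=> z; apply: (@continuousV _ _ (fun z => 1 + eucl_dist p z + eucl_dist z 0)).
    by move: (chart_scale_gt0 z); rewrite invr_gt0 => h; rewrite /= gt_eqF.
  have id_cont : continuous (fun z : 'rV[R]_2 => z) by move=> ?; exact: cvg_id.
  have c1 : continuous (eucl_dist p : 'rV[R]_2 -> R).
    by apply: continuous_eucl_dist => //; exact: cst_continuous.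
  have c0 : continuous (eucl_dist^~ 0 : 'rV[R]_2 -> R).
    by apply: continuous_eucl_dist => //; exact: cst_continuous.
  apply: (@continuousD _ _ _ (fun z => 1 + eucl_dist p z)); last exact: c0.
  apply: (@continuousD R R^o 'rV[R]_2 (fun=> 1) (eucl_dist p) z); last exact: c1.
  exact: cst_continuous.
have cc : continuous (@chart_inv_config R).
  apply: (@continuous_comp_initial _ _ _ (set_val : config R -> _)).
  have -> : set_val \o @chart_inv_config R =
      (fun z => (0, chart_scale z *: p, chart_scale z *: z)).
    by apply/funext => z /=; rewrite set_valE.
  have c_pair (U V : topologicalType) (f : 'rV[R]_2 -> U) (g : 'rV[R]_2 -> V) :
      continuous f -> continuous g -> continuous (fun z => (f z, g z)).
    by move=> cf cg z; exact: (cvg_pair (cf z) (cg z)).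
  apply: (@c_pair _ _ (fun z => ((0 : 'rV[R]_2), chart_scale z *: p))
                      (fun z => chart_scale z *: z)).
    apply: (@c_pair _ _ (fun=> (0 : 'rV[R]_2)) (fun z => chart_scale z *: p)).
      exact: cst_continuous.
    by move=> z; apply: continuousZr_tmp; exact: cs.
  by move=> z; apply: continuousZ; [exact: cs | exact: cvg_id].
move=> z; apply: (@continuous_comp _ _ _ (@chart_inv_config R) (\pi_(M3 R))).
  exact: cc.
exact: pi_continuous.
Qed.

End ChartOfM3.

(** * Critical points and minima of the Coulomb energy, read in the chart *)

Section CoulombInChart.
Variables (R : realType) (q1 q2 q3 t1 t2 t3 : R).
Hypotheses (h1 : t1 ^+ 2 = q2 * q3) (h2 : t2 ^+ 2 = q3 * q1) (h3 : t3 ^+ 2 = q1 * q2).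
Implicit Types (x y : M3 R) (z : 'rV[R]_2).

Local Notation p := (vec 1 0 : 'rV[R]_2).
Local Notation e0 := (delta_mx 0 0 : 'rV[R]_2).
Local Notation e1 := (delta_mx 0 1 : 'rV[R]_2).
Local Notation E := (coulomb q1 q2 q3).
Local Notation D := (denergy t1 t2 t3).
Local Notation D2 := (d2energy t1 t2 t3).

Lemma coulomb_comp_chart_inv : E \o @chart_inv R = energy t1 t2 t3.
Proof. by apply/funext => z; exact: coulomb_chart_inv. Qed.

Lemma coulomb_chart x : distinct x -> E x = energy t1 t2 t3 (chart x).
Proof. by move=> dx; rewrite -coulomb_comp_chart_inv /= chartK. Qed.

Lemma distinct_chart_neq x : distinct x -> p != chart x /\ 0 != chart x.
Proof.
by move=> dx; have := dx; rewrite -{1}[x]chartK // => /distinct_chart_inv[];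
  rewrite ![chart x == _]eq_sym.
Qed.

Lemma gradient_coulomb x i : distinct x ->
  gradient E x 0 i = D (delta_mx 0 i) (chart x).
Proof.
move=> /distinct_chart_neq[px x0].
by rewrite /gradient mxE coulomb_comp_chart_inv derive_energy.
Qed.

Lemma hessian_coulomb x i j : distinct x ->
  hessian E x i j = D2 (delta_mx 0 j) (delta_mx 0 i) (chart x).
Proof.
move=> /distinct_chart_neq[px x0].
by rewrite /hessian mxE coulomb_comp_chart_inv derive2_energy.
Qed.

Lemma critical_pointsP x : critical_points E x <->
  [/\ distinct x, D e0 (chart x) = 0 & D e1 (chart x) = 0].
Proof.
split=> [[dx /rowP g]|[dx g0 g1]].
  by split=> //; rewrite -gradient_coulomb // g mxE.
by split=> //; apply: vecP; rewrite gradient_coulomb // mxE.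
Qed.

Lemma saddle_pointsP x : critical_points E x ->
  0 < D2 e0 e0 (chart x) -> D2 e0 e1 (chart x) = D2 e1 e0 (chart x) ->
  saddle_points E x <->
  D2 e0 e0 (chart x) * D2 e1 e1 (chart x) - D2 e0 e1 (chart x) ^+ 2 < 0.
Proof.
move=> cx H00 sym; have [dx _] := cx.
have sym' : hessian E x 0 1 = hessian E x 1 0 by rewrite !hessian_coulomb.
have pos : 0 < hessian E x 0 0 by rewrite hessian_coulomb.
have := saddle_form2P sym' pos; rewrite det_mx22 -sym' -expr2 !hessian_coulomb // -sym.
by move=> <-; split=> [[]|[]].
Qed.

(** The set of the chart parameters of distinct configurations is open, so a
    local minimum on M(3) is one of the energy in the plane. *)
Lemma minimum_critical x : minimum_points E x ->
  critical_points E x /\ 0 <= D2 e1 e1 (chart x).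
Proof.
move=> [dx mx]; have [px x0] := distinct_chart_neq dx.
have locmin : \forall z \near chart x, energy t1 t2 t3 (chart x) <= energy t1 t2 t3 z.
  have mx' : \forall z \near chart x, distinct (chart_inv z) -> E x <= E (chart_inv z).
    have := @continuous_chart_inv R (chart x) [set y | distinct y -> E x <= E y].
    by rewrite chartK //; apply.
  apply: filterS3 mx' (near_neq px) (near_neq x0) => z h pz z0.
  rewrite -coulomb_chart // -coulomb_comp_chart_inv; apply/h/distinct_chart_inv.
  by split; rewrite eq_sym.
have second (v : 'rV[R]_2) : D v (chart x) = 0 /\ 0 <= D2 v v (chart x).
  apply: local_min_second_order locmin _ _; last exact: is_derive_denergy.
  by apply: filterS2 (near_neq px) (near_neq x0) => z pz z0; exact: is_derive_energy.
by split; [apply/critical_pointsP; split=> //; exact: (second _).1 | exact: (second _).2].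
Qed.

Lemma global_minimum x : distinct x ->
  (forall z, p != z -> 0 != z -> energy t1 t2 t3 (chart x) <= energy t1 t2 t3 z) ->
  minimum_points E x.
Proof.
move=> dx h; split=> //; apply: (filterS (F := nbhs x) _ filterT) => y _ dy.
by have [py y0] := distinct_chart_neq dy; rewrite !coulomb_chart //; exact: h.
Qed.

End CoulombInChart.

(** * Collisions and poles *)

Section Poles.
Variables (R : realType).
Implicit Types (x y : M3 R) (z : 'rV[R]_2) (P Q : config R).
Local Open Scope quotient_scope.

Lemma side_ge0 x : [/\ 0 <= l1 x, 0 <= l2 x & 0 <= l3 x].
Proof. by split; exact: eucl_dist_ge0. Qed.

Lemma side_gt0 x : distinct x -> [/\ 0 < l1 x, 0 < l2 x & 0 < l3 x].
Proof.
move=> [/meet12E n12 /meet23E n23 /meet13E n13]; have [a b c] := side_ge0 x.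
by split; rewrite lt_neqAle eq_sym; apply/andP; split => //; apply/eqP.
Qed.

Lemma pole_of_short_side (f : M3 R -> R) (l : M3 R -> R) (c : R) x :
  0 < c -> continuous l -> l x = 0 ->
  (forall y, distinct y -> 0 < l y /\ c / l y <= f y) -> poles f x.
Proof.
move=> c0 cl lx hf; apply/cvgryPgt => A; rewrite near_withinE.
pose e := c / (`|A| + 1).
have e0 : 0 < e by rewrite divr_gt0 // ltr_pwDr // normr_ge0.
have /cvgrPdist_lt /(_ e e0) := cl x; rewrite lx.
apply: filterS => y; rewrite sub0r normrN => lye dy; have [ly0 fy] := hf y dy.
have ly : l y < e by apply: le_lt_trans lye; exact: ler_norm.
apply: lt_le_trans fy; rewrite ltr_pdivlMr //.
have Ale : A < `|A| + 1 by rewrite (le_lt_trans (ler_norm A)) // ltrDl.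
have A1 : 0 < `|A| + 1 by rewrite ltr_pwDr // normr_ge0.
apply: (@le_lt_trans _ _ ((`|A| + 1) * l y)); first by rewrite ler_wpM2r // ltW.
by rewrite mulrC -ltr_pdivlMr.
Qed.

(** At a configuration with distinct points, divergence would force the energy
    of that configuration to exceed itself. *)
Lemma poles_coulomb (q1 q2 q3 : R) : 0 < q1 -> 0 < q2 -> 0 < q3 ->
  poles (coulomb q1 q2 q3) = [set x | meet12 x \/ meet23 x \/ meet13 x].
Proof.
move=> q10 q20 q30; have [c1 c2 c3] := continuous_sides R.
apply/seteqP; split=> [x /cvgryPgt pole|x].
  apply: contrapT => nm; have dx : distinct x.
    by split=> m; apply: nm; [left | right; left | right; right].
  have := pole (coulomb q1 q2 q3 x); rewrite near_withinE => /nbhs_singleton /(_ dx).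
  by rewrite ltxx.
have bound y : distinct y ->
    [/\ 0 < l3 y /\ q1 * q2 / l3 y <= coulomb q1 q2 q3 y,
        0 < l1 y /\ q2 * q3 / l1 y <= coulomb q1 q2 q3 y &
        0 < l2 y /\ q3 * q1 / l2 y <= coulomb q1 q2 q3 y].
  move=> /side_gt0[a b c]; rewrite /coulomb.
  have : 0 < q1 * q2 / l3 y by rewrite divr_gt0 ?mulr_gt0.
  have : 0 < q2 * q3 / l1 y by rewrite divr_gt0 ?mulr_gt0.
  have : 0 < q3 * q1 / l2 y by rewrite divr_gt0 ?mulr_gt0.
  by move=> ? ? ?; split; split=> //; lra.
move=> /= [/meet12E m|[/meet23E m|/meet13E m]].
- by apply: (pole_of_short_side (mulr_gt0 q10 q20) c3 m) => y /bound[].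
- by apply: (pole_of_short_side (mulr_gt0 q20 q30) c1 m) => y /bound[].
- by apply: (pole_of_short_side (mulr_gt0 q30 q10) c2 m) => y /bound[].
Qed.

(** The rotation is multiplication by the complex number w / v = c + i s. *)
Lemma same_length_rotation (v w : 'rV[R]_2) : eucl_dist 0 v = eucl_dist 0 w ->
  exists2 A : 'M[R]_2, SO2 A & w = v *m A.
Proof.
move=> vw; have sq (u : 'rV[R]_2) : eucl_dist 0 u ^+ 2 = u 0 0 ^+ 2 + u 0 1 ^+ 2.
  by rewrite sqr_eucl_dist /inner2 subr0 !expr2.
pose n := v 0 0 ^+ 2 + v 0 1 ^+ 2.
have nE : n = w 0 0 ^+ 2 + w 0 1 ^+ 2 by rewrite /n -!sq vw.
have [n0|n0] := eqVneq n 0.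
  exists 1%:M; first by split; rewrite ?det1 // trmx1 mulmx1.
  have z0 (u : 'rV[R]_2) : u 0 0 ^+ 2 + u 0 1 ^+ 2 = 0 -> u = 0.
    by rewrite -sq => /eqP; rewrite expf_eq0 /= eucl_dist_eq0 => /eqP.
  have w0 : w 0 0 ^+ 2 + w 0 1 ^+ 2 = 0 by rewrite -nE.
  by rewrite mulmx1 (z0 _ w0) (z0 _ n0).
pose c := (v 0 0 * w 0 0 + v 0 1 * w 0 1) / n.
pose s := (v 0 0 * w 0 1 - v 0 1 * w 0 0) / n.
pose A : 'M[R]_2 := \matrix_(i, j)
  (if i == 0 then if j == 0 then c else s else if j == 0 then - s else c).
have cs : c ^+ 2 + s ^+ 2 = 1.
  have -> : c ^+ 2 + s ^+ 2 = n * (w 0 0 ^+ 2 + w 0 1 ^+ 2) / n ^+ 2.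
    by rewrite /c /s /n; field.
  by rewrite -nE -expr2 divff // expf_neq0.
exists A.
  split; last by rewrite det_mx22 !mxE /= -cs; ring.
  apply/matrixP => i j; rewrite !mxE !big_ord_recl !big_ord0 !mxE /=.
  by case: i j => -[|[|//]] ? [[|[|//]] ?] //=; rewrite -?cs; ring.
by apply: vecP; rewrite ?mulrv0 ?mulrv1 !mxE /= /c /s /n; field.
Qed.

Lemma ray_normalized (al be : R) : `|al| + `|al - be| + `|be| = 2 ->
  normalized (0, al *: vec (1 / 2) 0, be *: vec (1 / 2) 0 : 'rV[R]_2).
Proof.
move=> h; have v1 (k : R) : k *: vec (1 / 2) 0 = vec (k / 2) 0 :> 'rV[R]_2.
  by apply: vecP; rewrite !mxE /= ?mulr0 ?div1r.
split=> //=; rewrite !v1 -(vec00 R) !eucl_dist_line subr0 sub0r normrN -mulrBl.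
have half : `|2^-1| = 2^-1 :> R by rewrite gtr0_norm ?invr_gt0.
by rewrite !normrM half [`|be - al|]distrC; lra.
Qed.

(** A collision makes p_2 and p_3 fixed multiples of one vector, whose length is
    imposed by the perimeter; all such configurations differ by a rotation. *)
Lemma ray_set1 (al be : R) (S : set (M3 R)) :
  `|al| + `|al - be| + `|be| = 2 ->
  (forall P, S (\pi_(M3 R) P) <->
     exists v, p2 P = al *: v /\ p3 P = be *: v) ->
  exists x, S = [set x].
Proof.
move=> h hS.
pose P0 : config R := SigSub (mem_set (ray_normalized h)).
have P02 : p2 P0 = al *: vec (1 / 2) 0 by rewrite /p2 set_valE.
have P03 : p3 P0 = be *: vec (1 / 2) 0 by rewrite /p3 set_valE.
exists (\pi_(M3 R) P0); apply/seteqP; split=> [x|x ->]; last first.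
  by apply/hS; exists (vec (1 / 2) 0).
rewrite -[x]reprK => /hS[v [e2 e3]]; apply/esym/M3_eqP.
have dv (w : 'rV[R]_2) (Q : config R) : p2 Q = al *: w -> p3 Q = be *: w -> eucl_dist 0 w = 1 / 2.
  move=> E2 E3; have := perimeterE Q; rewrite p1_eq0 E2 E3.
  have dZ (k m : R) : eucl_dist (k *: w) (m *: w) = `|k - m| * eucl_dist 0 w.
    rewrite !eucl_distE !mxE -sqrtr_sqr -sqrtrM ?sqr_ge0 //.
    by congr (Num.sqrt _); ring.
  rewrite -{1 2}(scale0r w) !dZ sub0r normrN subr0 -!mulrDl h; lra.
have [|A rA eA] := @same_length_rotation (vec (1 / 2) 0) v.
  by rewrite (dv _ _ P02 P03) (dv _ _ e2 e3).
exists A => //; rewrite !p1_eq0 mul0mx P02 P03 e2 e3 eA !scalemxAl.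
by split.
Qed.

Lemma meet_set1 : [/\ exists x : M3 R, [set x | meet12 x] = [set x],
  exists x : M3 R, [set x | meet23 x] = [set x] &
  exists x : M3 R, [set x | meet13 x] = [set x]].
Proof.
split.
- apply: (@ray_set1 0 1) => [|P]; first by rewrite normr0 sub0r normrN normr1; ring.
  rewrite /= meet12E l3_pi p1_eq0; split=> [/eqP|[v [-> _]]].
    by rewrite eucl_dist_eq0 => /eqP <-; exists (p3 P); rewrite scale0r scale1r.
  by apply/eqP; rewrite scale0r eucl_dist_eq0.
- apply: (@ray_set1 1 1) => [|P]; first by rewrite subrr normr0 normr1; ring.
  rewrite /= meet23E l1_pi; split=> [/eqP|[v [-> ->]]].
    by rewrite eucl_dist_eq0 => /eqP <-; exists (p2 P); rewrite scale1r.
  by apply/eqP; rewrite eucl_dist_eq0.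
- apply: (@ray_set1 1 0) => [|P]; first by rewrite subr0 normr0 normr1; ring.
  rewrite /= meet13E l2_pi p1_eq0; split=> [/eqP|[v [_ ->]]].
    by rewrite eucl_dist_eq0 => /eqP ->; exists (p2 P); rewrite scale0r scale1r.
  by apply/eqP; rewrite scale0r eucl_dist_eq0.
Qed.

Lemma perimeter_sides x : l1 x + l2 x + l3 x = 1.
Proof. by rewrite -(perimeterE (repr x)) /l1 /l2 /l3; ring. Qed.

Lemma two_meets x : [/\ ~ (meet12 x /\ meet23 x), ~ (meet23 x /\ meet13 x) &
  ~ (meet13 x /\ meet12 x)].
Proof.
have dd (a : 'rV[R]_2) : eucl_dist a a = 0 by apply/eqP; rewrite eucl_dist_eq0.
have := perimeter_sides x; rewrite /l1 /l2 /l3 /meet12 /meet23 /meet13 => per.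
split=> -[e1 e2]; move: per.
- by rewrite e1 e2 !dd; lra.
- by rewrite e1 e2 !dd; lra.
- by rewrite -e1 -e2 !dd; lra.
Qed.

End Poles.

(** * The aligned configurations A_1, A_2, A_3 and the mirror symmetry *)

Section AlignedConfigurations.
Variable R : realType.
Implicit Types (x y : M3 R) (z a b c : 'rV[R]_2) (P Q : config R).
Local Open Scope quotient_scope.

Lemma eucl_dist_scale_sub a b c (t : R) :
  0 <= t -> c - a = t *: (b - a) -> eucl_dist a c = t * eucl_dist a b.
Proof.
move=> t0 e; rewrite -[RHS]ger0_norm ?mulr_ge0 ?eucl_dist_ge0 //.
rewrite -[LHS]ger0_norm ?eucl_dist_ge0 // -!sqrtr_sqr exprMn !sqr_eucl_dist e.
by rewrite /inner2 !mxE; congr Num.sqrt; ring.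
Qed.

(** Both conditions say that c is the barycenter of a and b with weights
    sqrt qj and sqrt qi, the point dividing the segment in the ratio
    sqrt qi : sqrt qj. *)
Lemma balancedP (qi qj : R) a c b : 0 < qi -> 0 < qj ->
  let ri := Num.sqrt qi in let rj := Num.sqrt qj in
  balanced qi qj a c b <->
  a != b /\ c = (rj / (ri + rj)) *: a + (ri / (ri + rj)) *: b.
Proof.
move=> qi0 qj0 ri rj.
have ri0 : 0 < ri by rewrite sqrtr_gt0.
have rj0 : 0 < rj by rewrite sqrtr_gt0.
have rij : 0 < ri + rj by rewrite addr_gt0.
have dists (t : R) : 0 < t < 1 -> c = (1 - t) *: a + t *: b ->
    eucl_dist a c = t * eucl_dist a b /\ eucl_dist c b = (1 - t) * eucl_dist a b.
  move=> /andP[t0 t1] ->; split.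
    apply: eucl_dist_scale_sub; first exact: ltW.
    by rewrite scalerBl scale1r scalerBr addrAC [a - _ - a]addrAC subrr sub0r addrC.
  rewrite eucl_distC [eucl_dist a b]eucl_distC; apply: eucl_dist_scale_sub; first by lra.
  by apply/rowP => j; rewrite !mxE; ring.
split=> [[[ab [t t01 e]]]|[ab e]].
  have [-> ->] := dists t t01 e; have d0 : 0 < eucl_dist a b by rewrite eucl_dist_gt0.
  have [t0 t1] := andP t01; have t1' : 0 < 1 - t by lra.
  move=> ratio; split=> //.
  have {ratio} E : t * rj = (1 - t) * ri.
    have := congr1 (fun u => u * ((1 - t) * rj)) ratio.
    have -> : t * eucl_dist a b / ((1 - t) * eucl_dist a b) * ((1 - t) * rj) = t * rj.
      by field; rewrite !gt_eqF.
    by move=> ->; rewrite -/ri -/rj; field; rewrite gt_eqF.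
  have tE : t = ri / (ri + rj).
    apply: (mulIf (lt0r_neq0 rij)); rewrite divfK ?gt_eqF // mulrDr E; ring.
  by rewrite e tE; congr (_ *: _ + _); field; rewrite gt_eqF.
have t01 : 0 < ri / (ri + rj) < 1.
  by rewrite divr_gt0 //= ltr_pdivrMr // mul1r ltrDl.
have e' : c = (1 - ri / (ri + rj)) *: a + (ri / (ri + rj)) *: b.
  by rewrite e; congr (_ *: _ + _); field; rewrite gt_eqF.
have d0 : 0 < eucl_dist a b by rewrite eucl_dist_gt0.
split; first by split=> //; exists (ri / (ri + rj)).
have [-> ->] := dists _ t01 e'; rewrite -/ri -/rj; field.
by rewrite !gt_eqF.
Qed.

Lemma chart_inv_axisP x (k : R) : k != 0 -> k != 1 ->
  (p2 (repr x) != 0 /\ p3 (repr x) = k *: p2 (repr x)) <->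
  x = chart_inv (vec k 0).
Proof.
move=> k0 k1; split=> [[v0 e]|->].
  have dx : distinct x.
    split; rewrite /meet12 /meet23 /meet13 ?p1_eq0 ?e.
    - by move/esym/eqP; rewrite (negPf v0).
    - move=> /eqP; rewrite -subr_eq0 -{1}[p2 _]scale1r -scalerBl scaler_eq0.
      by rewrite subr_eq0 eq_sym (negPf k1) (negPf v0).
    - by move/esym/eqP; rewrite scaler_eq0 (negPf k0) (negPf v0).
  rewrite -{1}[x]chartK //; congr chart_inv; rewrite /chart /chart_config e.
  have n0 : p2 (repr x) 0 0 ^+ 2 + p2 (repr x) 0 1 ^+ 2 != 0.
    apply: contra_neq v0 => n; apply/eqP; rewrite eq_sym -eucl_dist_eq0.
    rewrite -(sqrf_eq0 (eucl_dist _ _)) sqr_eucl_dist /inner2 subr0 -!expr2.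
    by apply/eqP.
  by apply: vecP; rewrite !(vecE0, vecE1) !mxE; field.
have [A hA [_ -> ->]] := repr_rotated (chart_inv_config (vec k 0)).
rewrite p2_chart_inv p3_chart_inv; split; last first.
  rewrite scalemxAl; congr (_ *m _).
  by apply: vecP; rewrite !mxE /= ?mulr0 // mulr1 mulrC.
have n12 : ~ meet12 (\pi_(M3 R) (chart_inv_config (vec k 0))).
  by have /distinct_chart_inv[] : vec k 0 != 0 /\ vec k 0 != vec 1 0 :> 'rV[R]_2;
     first (split; apply/eqP => /rowP/(_ 0); rewrite !mxE /=; apply/eqP).
apply/eqP => v0; apply: n12; apply/meet12E; rewrite l3_pi p1_chart_inv p2_chart_inv.
rewrite -(eucl_distMr _ _ hA.1) mul0mx v0; apply/eqP; rewrite eucl_dist_eq0 //.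
Qed.

Section RatioOfCharges.
Variables (q1 q2 q3 : R).
Hypotheses (q1_gt0 : 0 < q1) (q2_gt0 : 0 < q2) (q3_gt0 : 0 < q3).
Local Notation r1 := (Num.sqrt q1).
Local Notation r2 := (Num.sqrt q2).
Local Notation r3 := (Num.sqrt q3).

Let r1_gt0 : 0 < r1. Proof. by rewrite sqrtr_gt0. Qed.
Let r2_gt0 : 0 < r2. Proof. by rewrite sqrtr_gt0. Qed.
Let r3_gt0 : 0 < r3. Proof. by rewrite sqrtr_gt0. Qed.

Lemma collinear_ratio x (k : R) : p2 (repr x) != 0 -> p3 (repr x) = k *: p2 (repr x) ->
  aligned x.
Proof.
move=> v0 e; exists 0, (p2 (repr x)); split=> //; exists 0, 1, k.
by rewrite p1_eq0 e !add0r scale0r scale1r.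
Qed.

Lemma A_1_set1 : A_1 q1 q2 q3 = [set chart_inv (vec (- (r3 / r2)) 0)].
Proof.
have k0 : - (r3 / r2) != 0 by rewrite oppr_eq0 gt_eqF ?divr_gt0.
have k1 : - (r3 / r2) != 1.
  by rewrite lt_eqF // (@lt_trans _ _ 0) ?ltr01 // oppr_lt0 divr_gt0.
have r23 : r2 + r3 != 0 by rewrite gt_eqF ?addr_gt0.
have n2 : r2 != 0 by rewrite gt_eqF.
have n3 : r3 != 0 by rewrite gt_eqF.
apply/seteqP; split=> x.
  move=> [_ /(balancedP _ _ _ q2_gt0 q3_gt0)[]]; rewrite p1_eq0.
  set v := p2 _; set w := p3 _ => vw e; apply/(chart_inv_axisP _ k0 k1); rewrite -/v -/w.
  have wE : w = - (r3 / r2) *: v.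
    apply/rowP => j; have /rowP/(_ j) := e; rewrite !mxE => ej.
    have : (r2 + r3) / r2 * (r3 / (r2 + r3) * v 0 j + r2 / (r2 + r3) * w 0 j) = 0.
      by rewrite -ej mulr0.
    have -> : (r2 + r3) / r2 * (r3 / (r2 + r3) * v 0 j + r2 / (r2 + r3) * w 0 j) =
       r3 / r2 * v 0 j + w 0 j by field; rewrite n2 r23.
    by move/eqP; rewrite addrC addr_eq0 -mulNr => /eqP.
  by split=> //; apply: contra_neq vw => v0; rewrite wE v0 scaler0.
move=> /(chart_inv_axisP _ k0 k1)[v0 e]; split; first exact: collinear_ratio e.
apply/(balancedP _ _ _ q2_gt0 q3_gt0); rewrite p1_eq0 e; split.
  rewrite -subr_eq0 -{1}[p2 _]scale1r -scalerBl scaler_eq0 (negPf v0) orbF.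
  by rewrite subr_eq0 eq_sym.
rewrite scalerA -scalerDl -[LHS](scale0r (p2 (repr x))); congr (_ *: _).
by field; rewrite n2 r23.
Qed.

Lemma A_2_set1 : A_2 q1 q2 q3 = [set chart_inv (vec (1 + r3 / r1) 0)].
Proof.
have r31 : 0 < r3 / r1 by rewrite divr_gt0.
have k0 : 1 + r3 / r1 != 0 by rewrite gt_eqF ?addr_gt0.
have k1 : 1 + r3 / r1 != 1 by rewrite gt_eqF // ltrDl.
have n31 : r3 + r1 != 0 by rewrite gt_eqF ?addr_gt0.
have n1 : r1 != 0 by rewrite gt_eqF.
apply/seteqP; split=> x.
  move=> [_ /(balancedP _ _ _ q3_gt0 q1_gt0)[]]; rewrite p1_eq0 scaler0 addr0 => w0 e.
  apply/(chart_inv_axisP _ k0 k1); rewrite e; split.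
    by rewrite scaler_eq0 negb_or w0 andbT mulf_neq0 // invr_neq0.
  rewrite scalerA -[LHS]scale1r; congr (_ *: _).
  by field; rewrite n1 n31.
move=> /(chart_inv_axisP _ k0 k1)[v0 e]; split; first exact: collinear_ratio e.
apply/(balancedP _ _ _ q3_gt0 q1_gt0); rewrite p1_eq0 e scaler0 addr0; split.
  by rewrite scaler_eq0 negb_or k0.
rewrite scalerA -[LHS]scale1r; congr (_ *: _).
by field; rewrite n1 n31.
Qed.

Lemma A_3_set1 : A_3 q1 q2 q3 = [set chart_inv (vec (r1 / (r1 + r2)) 0)].
Proof.
have r12 : 0 < r1 + r2 by rewrite addr_gt0.
have k0 : r1 / (r1 + r2) != 0 by rewrite gt_eqF ?divr_gt0.
have k1 : r1 / (r1 + r2) != 1 by rewrite lt_eqF // ltr_pdivrMr // mul1r ltrDl.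
apply/seteqP; split=> x.
  move=> [_ /(balancedP _ _ _ q1_gt0 q2_gt0)[]]; rewrite p1_eq0 scaler0 add0r => v0 e.
  by apply/(chart_inv_axisP _ k0 k1); rewrite eq_sym.
move=> /(chart_inv_axisP _ k0 k1)[v0 e]; split; first exact: collinear_ratio e.
by apply/(balancedP _ _ _ q1_gt0 q2_gt0); rewrite p1_eq0 e scaler0 add0r eq_sym.
Qed.

End RatioOfCharges.

(** A reflection of the plane conjugates z. *)
Lemma mirror_chart_inv z : z != 0 -> z != vec 1 0 ->
  mirror (chart_inv z) = chart_inv (vec (z 0 0) (- z 0 1)).
Proof.
move=> z0 z1; set x := chart_inv z.
have dx : distinct x by apply/distinct_chart_inv.
have F0 (u : 'rV[R]_2) : (u *m reflx) 0 0 = u 0 0.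
  by rewrite mulrv0 !mxE /= mulr1 mulr0 addr0.
have F1 (u : 'rV[R]_2) : (u *m reflx) 0 1 = - u 0 1.
  by rewrite mulrv1 !mxE /= mulr0 add0r mulrN mulr1.
have dist_refl (u v : 'rV[R]_2) : eucl_dist (u *m reflx) (v *m reflx) = eucl_dist u v.
  by rewrite !eucl_distE !F0 !F1 -(sqrrN (u 0 1 - _)); congr (Num.sqrt (_ + _ ^+ 2)); ring.
have e1 : p1 (mirror_config (repr x)) = p1 (repr x) *m reflx by rewrite /p1 set_valE.
have e2 : p2 (mirror_config (repr x)) = p2 (repr x) *m reflx by rewrite /p2 set_valE.
have e3 : p3 (mirror_config (repr x)) = p3 (repr x) *m reflx by rewrite /p3 set_valE.
have dmx : distinct (mirror x).
  case: dx => n12 n23 n13; split.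
  - by move/meet12E; rewrite l3_pi e1 e2 dist_refl; move/meet12E: n12.
  - by move/meet23E; rewrite l1_pi e2 e3 dist_refl; move/meet23E: n23.
  - by move/meet13E; rewrite l2_pi e1 e3 dist_refl; move/meet13E: n13.
rewrite -[LHS]chartK //; congr chart_inv.
have cz : chart_config (repr x) = z by rewrite -[RHS]chart_invK.
rewrite chart_pi -[in RHS]cz /chart_config e2 e3 !F0 !F1.
by apply: vecP; rewrite !(vecE0, vecE1) sqrrN ?mulrNN //; ring.
Qed.

End AlignedConfigurations.

(** * Classification of saddles and minima *)

Section Classification.
Variables (R : realType) (q1 q2 q3 t1 t2 t3 : R).
Hypotheses (t1_gt0 : 0 < t1) (t2_gt0 : 0 < t2) (t3_gt0 : 0 < t3).
Hypotheses (h1 : t1 ^+ 2 = q2 * q3) (h2 : t2 ^+ 2 = q3 * q1) (h3 : t3 ^+ 2 = q1 * q2).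
Implicit Types (x y : M3 R) (z : 'rV[R]_2).

Local Notation p := (vec 1 0 : 'rV[R]_2).
Local Notation e0 := (delta_mx 0 0 : 'rV[R]_2).
Local Notation e1 := (delta_mx 0 1 : 'rV[R]_2).
Local Notation E := (coulomb q1 q2 q3).
Local Notation D2 := (d2energy t1 t2 t3).
Local Notation B1 := (chart_inv (vec (ratio1 t2 t3) 0)).
Local Notation B2 := (chart_inv (vec (ratio2 t1 t3) 0)).
Local Notation B3 := (chart_inv (vec (ratio3 t1 t2) 0)).

Lemma distinct_chart_inv_neq z : p != z -> 0 != z -> distinct (chart_inv z).
Proof. by move=> pz z0; apply/distinct_chart_inv; split; rewrite eq_sym. Qed.

Lemma aligned_point z d : axis_critical t1 t2 t3 z d ->
  [/\ saddle_points E (chart_inv z) <-> d < 0,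
      minimum_points E (chart_inv z) -> 0 <= d &
      d = 0 -> degenerate_points E (chart_inv z)].
Proof.
move=> [pz z0 E0 E1 [H00 H01 H10 [c c0 H11]]].
have dx := distinct_chart_inv_neq pz z0.
have cx : critical_points E (chart_inv z).
  by apply/(critical_pointsP h1 h2 h3); rewrite chart_invK.
split.
- rewrite (saddle_pointsP h1 h2 h3 cx) chart_invK ?H01 ?H10 //.
  by rewrite H11 expr0n subr0 mulrA pmulr_rlt0 // mulr_gt0.
- by move=> /(minimum_critical h1 h2 h3)[_]; rewrite chart_invK H11 pmulr_rge0.
- move=> d0; split=> //; rewrite unitmxE unitfE negbK det_mx22.
  rewrite !(hessian_coulomb h1 h2 h3) // chart_invK H11 H01 H10 d0.
  by rewrite !mulr0 subrr.
Qed.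

Lemma triangle_not_saddle x : distinct x ->
  nondegenerate_triangle t1 t2 t3 (chart x) -> ~ saddle_points E x.
Proof.
move=> dx tri sx; have [H00 sym det0] := triangle_hessian t1_gt0 t2_gt0 t3_gt0 tri.
have [cx _ _] := sx.
by move/(saddle_pointsP h1 h2 h3 cx H00 sym) : sx; rewrite ltNge (ltW det0).
Qed.

Lemma critical_points_cases x : critical_points E x ->
  [\/ x = B1, x = B2, x = B3 | nondegenerate_triangle t1 t2 t3 (chart x)].
Proof.
move=> /(critical_pointsP h1 h2 h3)[dx E0 E1]; have [px x0] := distinct_chart_neq dx.
have [e|e|e|tri] := critical_cases t1_gt0 t2_gt0 t3_gt0 px x0 E0 E1; last exact: Or44.
- by apply: Or41; rewrite -e chartK.
- by apply: Or42; rewrite -e chartK.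
- by apply: Or43; rewrite -e chartK.
Qed.

Let aligned1 := aligned_point (axis_critical1 t1_gt0 t2_gt0 t3_gt0).
Let aligned2 := aligned_point (axis_critical2 t1_gt0 t2_gt0 t3_gt0).
Let aligned3 := aligned_point (axis_critical3 t1_gt0 t2_gt0 t3_gt0).

Lemma saddle_points_coulomb : saddle_points E =
  [set x | [\/ x = B1 /\ t1 < t2 + t3, x = B2 /\ t2 < t3 + t1 |
               x = B3 /\ t3 < t1 + t2]].
Proof.
have [[s1 _ _] [s2 _ _] [s3 _ _]] := And3 aligned1 aligned2 aligned3.
apply/seteqP; split=> x.
  move=> sx; have [cx _ _] := sx.
  have [e|e|e|tri] := critical_points_cases cx.
  - by apply: Or31; split=> //; rewrite e in sx; move/s1: sx; rewrite subr_lt0.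
  - by apply: Or32; split=> //; rewrite e in sx; move/s2: sx; rewrite subr_lt0.
  - by apply: Or33; split=> //; rewrite e in sx; move/s3: sx; rewrite subr_lt0.
  - by have [dx _] := cx; have := triangle_not_saddle dx tri sx.
by case=> -[-> lt]; [apply/s1|apply/s2|apply/s3]; rewrite subr_lt0.
Qed.

Lemma minimum_points_cases x : minimum_points E x ->
  [\/ x = B1 /\ t2 + t3 <= t1, x = B2 /\ t3 + t1 <= t2, x = B3 /\ t1 + t2 <= t3 |
      nondegenerate_triangle t1 t2 t3 (chart x)].
Proof.
have [[_ m1 _] [_ m2 _] [_ m3 _]] := And3 aligned1 aligned2 aligned3.
move=> mx; have [cx _] := minimum_critical h1 h2 h3 mx.
have [e|e|e|tri] := critical_points_cases cx; last exact: Or44.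
- by apply: Or41; split=> //; rewrite e in mx; move/m1: mx; rewrite subr_ge0.
- by apply: Or42; split=> //; rewrite e in mx; move/m2: mx; rewrite subr_ge0.
- by apply: Or43; split=> //; rewrite e in mx; move/m3: mx; rewrite subr_ge0.
Qed.

Lemma minimum_points_aligned : t2 + t3 <= t1 -> minimum_points E = [set B1].
Proof.
move=> t1_ge; apply/seteqP; split=> [x mx|_ ->].
  have [[->]//|[_ le]|[_ le]|/triangle_ineq_strict []//] := minimum_points_cases mx.
  - by exfalso; move: t3_gt0 le t1_ge; lra.
  - by exfalso; move: t2_gt0 le t1_ge; lra.
  - by move=> lt _ _; move: lt; rewrite ltNge t1_ge.
have [pz z0 _ _ _] := axis_critical1 t1_gt0 t2_gt0 t3_gt0.
apply: (global_minimum h1 h2 h3); first exact: distinct_chart_inv_neq.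
have k0 : 0 < t2 / t3 by rewrite divr_gt0.
move=> z pz' z0'; rewrite chart_invK /energy -{1}(vec00 R) !eucl_dist_line.
rewrite /ratio1 subr0 normrN (gtr0_norm k0) -normrN opprB opprK gtr0_norm; last by lra.
by apply: shape_energy_min_aligned; rewrite ?eucl_dist_gt0 ?eucl_dist_triangle_p.
Qed.

Lemma minimum_of_triangle z : nondegenerate_triangle t1 t2 t3 z ->
  minimum_points E (chart_inv z).
Proof.
move=> [y0 ea eb]; have pz : p != z by rewrite -eucl_dist_gt0 ea divr_gt0.
have z0 : 0 != z by rewrite -eucl_dist_gt0 eb divr_gt0.
apply: (global_minimum h1 h2 h3); first exact: distinct_chart_inv_neq.
move=> z' pz' z0'; rewrite chart_invK /energy ea eb.
by apply: shape_energy_min_triangle; rewrite ?eucl_dist_gt0.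
Qed.

(** The distances to 0 and 1 determine x and y^2. *)
Lemma nondegenerate_triangleP z z' : nondegenerate_triangle t1 t2 t3 z ->
  nondegenerate_triangle t1 t2 t3 z' <-> z' = z \/ z' = vec (z 0 0) (- z 0 1).
Proof.
move=> tri; have [y0 ea eb] := tri; split=> [[y0' ea' eb']|]; last first.
  case=> -> //; split; first by rewrite vecE1 oppr_eq0.
    by rewrite -ea !eucl_distE !mxE /= !sub0r !sqrrN.
  by rewrite -eb !eucl_distE !mxE /= !sub0r !sqrrN.
have xE (w : 'rV[R]_2) :
    w 0 0 = (1 + eucl_dist 0 w ^+ 2 - eucl_dist p w ^+ 2) / 2.
  by rewrite !sqr_eucl_dist /inner2 !mxE /=; field.
have yE (w : 'rV[R]_2) : w 0 1 ^+ 2 = eucl_dist 0 w ^+ 2 - w 0 0 ^+ 2.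
  by rewrite sqr_eucl_dist /inner2 !mxE /=; ring.
have x_eq : z' 0 0 = z 0 0 by rewrite xE ea' eb' -ea -eb -xE.
have /eqP : z' 0 1 ^+ 2 = z 0 1 ^+ 2 by rewrite !yE x_eq eb' eb.
rewrite eqf_sqr => /orP[/eqP y_eq|/eqP y_eq]; [left|right].
  by apply: vecP.
by rewrite [LHS]vec_eta x_eq y_eq.
Qed.

(** The height exists by Heron's formula: b^2 - x^2 is a product of positive
    defects of the triangle inequalities. *)
Lemma triangle_exists : t1 < t2 + t3 -> t2 < t3 + t1 -> t3 < t1 + t2 ->
  exists z, nondegenerate_triangle t1 t2 t3 z.
Proof.
move=> i1 i2 i3; pose a := t1 / t3; pose b := t2 / t3.
have a0 : 0 < a by rewrite divr_gt0.
have b0 : 0 < b by rewrite divr_gt0.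
have E1 : a * t3 = t1 by rewrite divfK ?gt_eqF.
have E2 : b * t3 = t2 by rewrite divfK ?gt_eqF.
have j1 : a < b + 1 by rewrite -(ltr_pM2r t3_gt0) mulrDl E1 E2 mul1r.
have j2 : b < 1 + a by rewrite -(ltr_pM2r t3_gt0) mulrDl E1 E2 mul1r.
have j3 : 1 < a + b by rewrite -(ltr_pM2r t3_gt0) mulrDl E1 E2 mul1r.
pose x := (1 + b ^+ 2 - a ^+ 2) / 2.
have y2 : 0 < b ^+ 2 - x ^+ 2.
  have -> : b ^+ 2 - x ^+ 2 =
      (a - b + 1) * (a + b - 1) * ((1 + b - a) * (1 + b + a)) / 4.
    by rewrite /x; field.
  by rewrite divr_gt0 // !mulr_gt0 //; lra.
have sqE : Num.sqrt (b ^+ 2 - x ^+ 2) ^+ 2 = b ^+ 2 - x ^+ 2 by rewrite sqr_sqrtr ?ltW.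
exists (vec x (Num.sqrt (b ^+ 2 - x ^+ 2))); split.
- by rewrite vecE1 gt_eqF // sqrtr_gt0.
- rewrite eucl_distE !mxE /= sub0r sqrrN sqE -[RHS]ger0_norm ?ltW // -sqrtr_sqr.
  by congr Num.sqrt; rewrite -/a /x; field.
- rewrite eucl_distE !mxE /= !sub0r !sqrrN sqE -[RHS]ger0_norm ?ltW // -sqrtr_sqr.
  by congr Num.sqrt; rewrite -/b; ring.
Qed.

Lemma minimum_points_triangle z : nondegenerate_triangle t1 t2 t3 z ->
  minimum_points E = [set chart_inv z; mirror (chart_inv z)].
Proof.
move=> tri; have [i1 i2 i3] := triangle_ineq_strict t1_gt0 t2_gt0 t3_gt0 tri.
have [y0 ea eb] := tri.
have pz : p != z by rewrite -eucl_dist_gt0 ea divr_gt0.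
have z0 : 0 != z by rewrite -eucl_dist_gt0 eb divr_gt0.
rewrite mirror_chart_inv 1?eq_sym //.
apply/seteqP; split=> [x mx|x /= [->|->]].
- have [dx _] := mx.
  have [[_ ?]|[_ ?]|[_ ?]|tri'] := minimum_points_cases mx; try by exfalso; move: i1 i2 i3; lra.
  rewrite -[x]chartK //; have [->|->] := (nondegenerate_triangleP _ tri).1 tri'.
    by left.
  by right.
- exact: minimum_of_triangle.
- by apply/minimum_of_triangle/(nondegenerate_triangleP _ tri); right.
Qed.

End Classification.

Unset Implicit Arguments.

Theorem theorem2 (R : realType) (q1 q2 q3 : R)
    (q1_gt0 : 0 < q1) (q2_gt0 : 0 < q2) (q3_gt0 : 0 < q3) :
  let E := coulomb q1 q2 q3 in
  let s1 := 1 / Num.sqrt q1 in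
  let s2 := 1 / Num.sqrt q2 in
  let s3 := 1 / Num.sqrt q3 in
  (exists P12 P23 P13 : M3 R,
    [/\ [set x | meet12 x] = [set P12],
        [set x | meet23 x] = [set P23] &
        [set x | meet13 x] = [set P13]] /\
    [/\ P12 <> P23, P23 <> P13 & P13 <> P12] /\
    poles E = [set P12; P23; P13]) /\
  (exists A1 A2 A3 : M3 R,
    [/\ A_1 q1 q2 q3 = [set A1],
        A_2 q1 q2 q3 = [set A2] &
        A_3 q1 q2 q3 = [set A3]] /\
    [/\ A1 <> A2, A2 <> A3 & A3 <> A1] /\
    [/\ (* (1) *)
        s1 < s2 + s3 -> s2 < s3 + s1 -> s3 < s1 + s2 ->
          (exists T T' : M3 R,
            [/\ T <> T', T' = mirror T,
                sides_proportional s1 s2 s3 T,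
                sides_proportional s1 s2 s3 T' &
                minimum_points E = [set T; T']]) /\
          saddle_points E = [set A1; A2; A3],
        (* (2) *)
        s1 > s2 + s3 ->
          minimum_points E = [set A1] /\
          saddle_points E = [set A2; A3] &
        (* (3) *)
        s1 = s2 + s3 ->
          (minimum_points E = [set A1] /\ degenerate_points E A1) /\
          saddle_points E = [set A2; A3]]).
Proof.
move=> E s1 s2 s3; split.
  have [[P12 e12] [P23 e23] [P13 e13]] := meet_set1 R.
  exists P12, P23, P13; split=> //.
  have m12 x : meet12 x <-> x = P12 by have := congr1 (@^~ x) e12; rewrite /= => ->.
  have m23 x : meet23 x <-> x = P23 by have := congr1 (@^~ x) e23; rewrite /= => ->.
  have m13 x : meet13 x <-> x = P13 by have := congr1 (@^~ x) e13; rewrite /= => ->.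
  split.
    have [n1 n2 n3] := two_meets P12; have [n4 n5 n6] := two_meets P23.
    split=> e.
    - by apply: n1; split; [exact/m12 | exact/m23].
    - by apply: n5; split; [exact/m23 | exact/m13].
    - by apply: n3; split; [exact/m13 | exact/m12].
  rewrite poles_coulomb //; apply/seteqP; split=> x /=.
    by move=> [/m12|[/m23|/m13]] ->; [left; left | left; right | right].
  by move=> [[->|->]|->]; [left; exact/m12 | right; left; exact/m23 | right; right; exact/m13].
pose r1 := Num.sqrt q1; pose r2 := Num.sqrt q2; pose r3 := Num.sqrt q3.
have r1_gt0 : 0 < r1 by rewrite sqrtr_gt0.
have r2_gt0 : 0 < r2 by rewrite sqrtr_gt0.
have r3_gt0 : 0 < r3 by rewrite sqrtr_gt0.
pose t1 := r2 * r3; pose t2 := r3 * r1; pose t3 := r1 * r2.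
have t1_gt0 : 0 < t1 by rewrite mulr_gt0.
have t2_gt0 : 0 < t2 by rewrite mulr_gt0.
have t3_gt0 : 0 < t3 by rewrite mulr_gt0.
have h1 : t1 ^+ 2 = q2 * q3 by rewrite exprMn !sqr_sqrtr ?ltW.
have h2 : t2 ^+ 2 = q3 * q1 by rewrite exprMn !sqr_sqrtr ?ltW.
have h3 : t3 ^+ 2 = q1 * q2 by rewrite exprMn !sqr_sqrtr ?ltW.
have n1 : r1 != 0 by rewrite gt_eqF.
have n2 : r2 != 0 by rewrite gt_eqF.
have n3 : r3 != 0 by rewrite gt_eqF.
have c0 : 0 < r1 * r2 * r3 by rewrite !mulr_gt0.
have s1E : t1 = s1 * (r1 * r2 * r3) by rewrite /t1 /s1 -/r1; field.
have s2E : t2 = s2 * (r1 * r2 * r3) by rewrite /t2 /s2 -/r2; field.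
have s3E : t3 = s3 * (r1 * r2 * r3) by rewrite /t3 /s3 -/r3; field.
have k1 : - (r3 / r2) = ratio1 t2 t3.
  by rewrite /ratio1 /t2 /t3; congr (- _); field; rewrite n1 n2.
have k2 : 1 + r3 / r1 = ratio2 t1 t3.
  by rewrite /ratio2 /t1 /t3; congr (_ + _); field; rewrite n1 n2.
have k3 : r1 / (r1 + r2) = ratio3 t1 t2.
  rewrite /ratio3 /t1 /t2; field.
  by rewrite !gt_eqF ?addr_gt0 ?mulr_gt0.
exists (chart_inv (vec (ratio1 t2 t3) 0)), (chart_inv (vec (ratio2 t1 t3) 0)),
  (chart_inv (vec (ratio3 t1 t2) 0)); split.
  by rewrite A_1_set1 // A_2_set1 // A_3_set1 // -/r1 -/r2 -/r3 k1 k2 k3.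
split.
  have inj (u v : R) : chart_inv (vec u 0) = chart_inv (vec v 0) -> u = v.
    by move=> /(congr1 chart); rewrite !chart_invK => /rowP/(_ 0); rewrite !vecE0.
  have u1 : ratio1 t2 t3 < 0 by rewrite oppr_lt0 divr_gt0.
  have u2 : 1 < ratio2 t1 t3 by rewrite ltrDl divr_gt0.
  have u3 : 0 < ratio3 t1 t2 < 1.
    by rewrite divr_gt0 ?addr_gt0 //= ltr_pdivrMr ?addr_gt0 // mul1r ltrDr.
  by have [u30 u31] := andP u3; split=> /inj e; lra.
have i1 : (s1 < s2 + s3) = (t1 < t2 + t3) by rewrite s1E s2E s3E -mulrDl ltr_pM2r.
have i2 : (s2 < s3 + s1) = (t2 < t3 + t1) by rewrite s1E s2E s3E -mulrDl ltr_pM2r.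
have i3 : (s3 < s1 + s2) = (t3 < t1 + t2) by rewrite s1E s2E s3E -mulrDl ltr_pM2r.
have saddles := saddle_points_coulomb t1_gt0 t2_gt0 t3_gt0 h1 h2 h3.
have saddles23 : t2 + t3 <= t1 -> saddle_points E =
    [set chart_inv (vec (ratio2 t1 t3) 0); chart_inv (vec (ratio3 t1 t2) 0)].
  move=> t1_ge; rewrite saddles; apply/seteqP; split=> x /=.
    by move=> [[_]|[-> _]|[-> _]]; [rewrite ltNge t1_ge | left | right].
  by move=> [->|->]; [apply: Or32 | apply: Or33]; split=> //; lra.
split.
- rewrite i1 i2 i3 => j1 j2 j3.
  have [z tri] := triangle_exists t1_gt0 t2_gt0 t3_gt0 j1 j2 j3.
  have [y0 ea eb] := tri.
  have tri' : nondegenerate_triangle t1 t2 t3 (vec (z 0 0) (- z 0 1)).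
    by apply/(nondegenerate_triangleP _ tri); right.
  have sides w : nondegenerate_triangle t1 t2 t3 w -> sides_proportional s1 s2 s3 (chart_inv w).
    move=> [_ ea' eb']; exists (chart_scale w * r3); first by rewrite mulr_gt0 ?chart_scale_gt0.
    rewrite l1_chart_inv l2_chart_inv l3_chart_inv ea' eb' /s1 /s2 /s3 -/r1 -/r2 -/r3.
    by rewrite /t1 /t2 /t3; split; field; rewrite ?n1 ?n2 ?n3.
  have z1 : z != vec 1 0 by rewrite eq_sym -eucl_dist_gt0 ea divr_gt0.
  have z0 : z != 0 by rewrite eq_sym -eucl_dist_gt0 eb divr_gt0.
  split.
    exists (chart_inv z), (mirror (chart_inv z)).
    have mE := mirror_chart_inv z0 z1.
    split=> //.
    + rewrite mE => /(congr1 chart); rewrite !chart_invK => /rowP/(_ 1).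
      rewrite vecE1 => e; move/eqP: y0; apply; lra.
    + exact: sides.
    + by rewrite mE; exact: sides.
    + exact: (minimum_points_triangle t1_gt0 t2_gt0 t3_gt0 h1 h2 h3 tri).
  rewrite saddles; apply/seteqP; split=> x /=.
    by move=> [[-> _]|[-> _]|[-> _]]; [left; left | left; right | right].
  by move=> [[->|->]|->]; [apply: Or31 | apply: Or32 | apply: Or33].
- rewrite -[s2 + s3 < s1](ltr_pM2r c0) mulrDl -s1E -s2E -s3E => /ltW t1_ge.
  by split; [exact: (minimum_points_aligned t1_gt0 t2_gt0 t3_gt0 h1 h2 h3) | exact: saddles23].
- move=> e; have te : t1 = t2 + t3 by rewrite s1E s2E s3E e mulrDl.
  have t1_ge : t2 + t3 <= t1 by rewrite te.
  split; last exact: saddles23.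
  split; first exact: (minimum_points_aligned t1_gt0 t2_gt0 t3_gt0 h1 h2 h3).
  have [_ _] := aligned_point h1 h2 h3 (axis_critical1 t1_gt0 t2_gt0 t3_gt0).
  by apply; rewrite te subrr.
Qed.
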